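(* Consider the one-bit-feedback opportunistic interference alignment scheme described in the context with $d=1$, so that $N_R=2$ and the channel matrices are $2\times 1$. Let $d'\in[0,1]$. Suppose the number of users per cell is scaled as $K\propto P^{d'}$, that is, $K=K(P)\ge 2$ is an integer with $K(P)/P^{d'}\to\kappa$ for some constant $\kappa\in(0,\infty)$ as $P\to\infty$. Suppose further that the threshold is chosen as $$\hat{x}=1-\Big(\frac{1}{K}\Big)^{\frac{1}{K-1}}.$$ Then each transmitter $i$ achieves DoF $d'$, that is, $$\liminf_{P\to\infty}\frac{\mathbb{E}[R_i^{k^\dagger}]}{\log_2 P}\ge d'.$$
   Context: System model. Fix an integer $d\ge 1$ and set $N_R=2d$. There are three cells $i\in\{1,2,3\}$; transmitter $i$ serves $K$ users $k\in\{1,\dots,K\}$ in cell $i$. The effective channel from transmitter $j$ to user $k$ in cell $i$ is $\mathbf{H}_{i,j}^k\in\mathbb{C}^{N_R\times d}$. All entries of all these matrices are i.i.d. circularly symmetric complex Gaussian with zero mean and unit variance. Transmitter $j$ sends $\mathbf{s}_j\in\mathbb{C}^d$ with $\mathbb{E}[\mathbf{s}_j\mathbf{s}_j^H]=\frac{P}{d}\mathbf{I}_d$. The noise is $\mathcal{CN}(0,\mathbf{I}_{N_R})$, and the SNR equals $P$. For cell $i$, let $p=(i+1 \bmod 3)$ and $q=(i+2\bmod 3)$ index the two other (interfering) transmitters. Metric. For matrices $\mathbf{A},\mathbf{B}\in\mathbb{C}^{N_R\times d}$ with orthonormal columns, the chordal distance is $d_c(\mathbf{A},\mathbf{B})=\frac{1}{\sqrt2}\|\mathbf{A}\mathbf{A}^H-\mathbf{B}\mathbf{B}^H\|_F$.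 User $k$ in cell $i$ computes orthonormal bases $\mathbf{Q}_{ip}^k,\mathbf{Q}_{iq}^k$ of the column spaces of $\mathbf{H}_{i,p}^k$ and $\mathbf{H}_{i,q}^k$, and the metric $\mathcal{D}_i^k=d_c^2(\mathbf{Q}_{ip}^k,\mathbf{Q}_{iq}^k)$. One-bit scheme with threshold $x$. Each user reports bit 1 if $\mathcal{D}_i^k<x$ and bit 0 otherwise. Transmitter $i$ selects a user $k^\dagger$ uniformly at random among those reporting 1. If all users report 0 (scheduling outage), it selects $k^\dagger$ uniformly at random among all $K$ users. Receiver and rate. With $\mathbf{R}_i^k=\mathbf{H}_{i,p}^k{\mathbf{H}_{i,p}^k}^H+\mathbf{H}_{i,q}^k{\mathbf{H}_{i,q}^k}^H$, the postfilter $\mathbf{U}_i^k\in\mathbb{C}^{N_R\times d}$ consists of the singular vectors of $\mathbf{R}_i^k$ associated with its $d+1,\dots,N_R$-th largest singular values. The rate of user $k$ is $$R_i^k=\log_2\det\Big(\mathbf{I}_d+\tfrac{P}{d}{\mathbf{U}_i^k}^H\mathbf{H}_{i,i}^k{\mathbf{H}_{i,i}^k}^H\mathbf{U}_i^k\Big(\mathbf{I}_d+\tfrac{P}{d}\sum_{j\ne i}{\mathbf{U}_i^k}^H\mathbf{H}_{i,j}^k{\mathbf{H}_{i,j}^k}^H\mathbf{U}_i^k\Big)^{-1}\Big).$$ The DoF achieved at transmitter $i$ is $\lim_{P\to\infty}\mathbb{E}[R_i^{k^\dagger}]/\log_2P$. The expectation is over the channels and the random selection. *)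

(* Defs.v *)
From HB Require Import structures.
From mathcomp Require Import all_boot all_order all_algebra.
From mathcomp Require Import all_classical all_reals all_analysis.
From mathcomp Require Import complex.

Set Implicit Arguments.
Unset Strict Implicit.
Unset Printing Implicit Defensive.

Import Order.TTheory GRing.Theory Num.Def Num.Theory.
Import numFieldNormedType.Exports.

Local Open Scope classical_set_scope.
Local Open Scope ring_scope.
Local Open Scope complex_scope.

Section OIA.
Context {R : realType}.
Local Notation C := (R[i]).

Definition adjmx (m n : nat) (A : 'M[C]_(m, n)) : 'M[C]_(n, m) :=
  (map_mx Num.conj A)^T.

Definition frob2 (m n : nat) (A : 'M[C]_(m, n)) : R :=
  \sum_(a < m) \sum_(b < n) (complex.Re (A a b) ^+ 2 + complex.Im (A a b) ^+ 2).

Definition chordal_dist (A B : 'M[C]_(2, 1)) : R :=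
  (Num.sqrt 2)^-1 * Num.sqrt (frob2 (A *m adjmx A - B *m adjmx B)).

Definition is_onb_colspace (H Q : 'M[C]_(2, 1)) : Prop :=
  adjmx Q *m Q = 1%:M /\ (Q^T == H^T)%MS.

(* the orthonormal basis computed by the user (a choice; the metric does
   not depend on which one is chosen) *)
Definition onb (H : 'M[C]_(2, 1)) : 'M[C]_(2, 1) :=
  xget 0 [set Q | is_onb_colspace H Q].

Definition metric (Hp Hq : 'M[C]_(2, 1)) : R :=
  chordal_dist (onb Hp) (onb Hq) ^+ 2.

(* u is a (left) singular vector of the 2x2 matrix M associated with its
   second largest (d+1 = 2nd, ..., N_R = 2nd) singular value:
   M = W diag(s1, s2) V^H with W, V unitary, s1 >= s2 >= 0, u = 2nd column of W *)
Definition is_postfilter (M : 'M[C]_2) (u : 'M[C]_(2, 1)) : Prop :=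
  exists (W V : 'M[C]_2) (s : 'rV[R]_2),
    [/\ adjmx W *m W = 1%:M, adjmx V *m V = 1%:M,
        0 <= s ord0 (lift ord0 ord0) <= s ord0 ord0,
        M = W *m diag_mx (map_mx (fun x : R => x%:C) s) *m adjmx V
      & u = col (lift ord0 ord0) W].

Definition Rmx (Hp Hq : 'M[C]_(2, 1)) : 'M[C]_2 :=
  Hp *m adjmx Hp + Hq *m adjmx Hq.

Definition postfilter (Hp Hq : 'M[C]_(2, 1)) : 'M[C]_(2, 1) :=
  xget 0 [set u | is_postfilter (Rmx Hp Hq) u].

Definition log2 (x : R) : R := ln x / ln 2.

(* rate R_i^k with d = 1 (so P/d = P); Hi = H_{i,i}, Hp, Hq the interfering
   channels.  The determinant of the 1x1 matrix is real; we take its real part. *)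
Definition rate (P : R) (Hi Hp Hq : 'M[C]_(2, 1)) : R :=
  let U := postfilter Hp Hq in
  log2 (complex.Re (\det (1%:M + P%:C *: (adjmx U *m Hi *m adjmx Hi *m U) *m
          invmx (1%:M + P%:C *: (adjmx U *m Hp *m adjmx Hp *m U
                                + adjmx U *m Hq *m adjmx Hq *m U))))).

(* Randomness.  A sample point w : nat -> R lists the real and imaginary    *)
(* parts of all channel entries of the users in cell i.  Each coordinate is *)
(* N(0, 1/2), so each complex entry is CN(0,1).                             *)

(* index of the (real/imag part c) of entry r of H_{i,j}^k *)
Definition coord (k j r c : nat) : nat := ((k * 3 + j) * 2 + r) * 2 + c.

Definition chan (w : nat -> R) (k : nat) (j : 'I_3) : 'M[C]_(2, 1) :=
  \matrix_(r < 2, c < 1) (w (coord k j r 0) +i* w (coord k j r 1)).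

(* Expectation w.r.t. n i.i.d. N(0, s^2) coordinates w 0, ..., w (n-1)
   (remaining coordinates are irrelevant and set to 0), as an iterated
   Lebesgue integral against the normal probability measure. *)
Fixpoint gauss_expect (s : R) (n : nat) (f : (nat -> R) -> \bar R) : \bar R :=
  match n with
  | 0 => f (fun _ => 0)
  | n'.+1 => (\int[normal_prob 0 s]_x
                gauss_expect s n' (fun w => f (fun m => if m == n' then x else w m)))%E
  end.

Definition other1 (i : 'I_3) : 'I_3 := inZp (i.+1).
Definition other2 (i : 'I_3) : 'I_3 := inZp (i.+2).

(* one-bit feedback + random scheduling: given the channels, the expected
   rate of the scheduled user k^dagger over the uniform random choice *)
Definition sched_rate (i : 'I_3) (K : nat) (x P : R) (w : nat -> R) : R :=
  let rk := fun k : 'I_K => rate P (chan w k i) (chan w k (other1 i)) (chan w k (other2 i)) in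
  let S := [set k : 'I_K | metric (chan w k (other1 i)) (chan w k (other2 i)) < x] in
  if (0 < #|S|)%N then (#|S|%:R)^-1 * \sum_(k in S) rk k
  else (K%:R)^-1 * \sum_(k : 'I_K) rk k.

Definition expected_rate (i : 'I_3) (K : nat) (x P : R) : \bar R :=
  gauss_expect (Num.sqrt (2^-1)) (K * 12) (fun w => (sched_rate i K x P w)%:E).

Definition threshold (K : nat) : R :=
  1 - (K%:R)^-1 `^ ((K%:R - 1)^-1).

End OIA.

(* Main.v *)
(* In C^2 the metric of a user is D = |det(p, q)|^2 / (|p|^2 |q|^2), where p and q are the
   interfering channels, and the postfilter u leaves residual interference at most
   2 |det(p, q)|^2 / (|p|^2 + |q|^2) <= 2 D |p|^2.  So for a user with D < x whose channels
   have squared norm at most M and for which |det(p, h)|^2 >= delta |p|^2, h being the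
   desired channel, the rate is at least log2 (1 + P (delta / 4) / (1 + 2 P x M)).

   Call the other users with D < x bad.  A user is bad with probability at most
   z = 24 exp (- M / 8) + 64 x M delta: given p, the events that q is nearly parallel to p and
   that h is nearly parallel to p are independent, and each confines a Gaussian to a disc.
   Conversely D < x has probability at least c x for a constant c.  Users being independent,
   some user has D < x and no user is bad with probability at least (1 - z)^K - (1 - c x)^K,
   which tends to 1 for M = 16 ln P and delta = P^-eta, since K x is of the order of ln K.
   As x is of the order of P^-d' ln P, the rate is then at least (d' - 3 eta) log2 P.
   Outside this event the rate is only used to be nonnegative.

   The iterated integral [gauss_expect] is handled through operators that integrate out one
   coordinate of a function of a sequence; they commute by Fubini-Tonelli. *)

Require Import Defs.
From HB Require Import structures.
From mathcomp Require Import all_boot all_order all_algebra.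
From mathcomp Require Import all_classical all_reals all_analysis.
From mathcomp Require Import perm spectral measurable_realfun complex.
From mathcomp Require Import zify ring lra.

Set Implicit Arguments.
Unset Strict Implicit.
Unset Printing Implicit Defensive.

Import Order.TTheory GRing.Theory Num.Def Num.Theory.
Import numFieldNormedType.Exports.
Local Open Scope classical_set_scope.
Local Open Scope ring_scope.

(** * Integrating out coordinates *)

Section coordinate_operators.
Context {R : realType}.

(** Generators of the product sigma-algebra on sequences, which makes Tonelli's theorem available
    for functions of all coordinates. *)
Definition cylinders : set (set (nat -> R)) :=
  [set A | exists n B, measurable B /\ A = (fun w => w n) @^-1` B].

Definition sample : Type := g_sigma_algebraType cylinders.
HB.instance Definition _ := Measurable.on sample.

Lemma measurable_coordinate n : measurable_fun setT (fun w : sample => w n).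
Proof.
move=> _ B mB; rewrite setTI; apply: sub_sigma_algebra.
by exists n, B.
Qed.

Lemma measurable_to_sample d (T : measurableType d) (f : T -> sample) :
  (forall n, measurable_fun setT (fun t => f t n)) -> measurable_fun setT f.
Proof.
move=> mf; apply: (@measurability _ _ _ sample _ _ cylinders) => // _ [_ [n [B [mB ->]] <-]].
exact: (mf n measurableT B mB).
Qed.

Definition upd (w : nat -> R) (n : nat) (x : R) : nat -> R :=
  fun m => if m == n then x else w m.

Lemma measurable_upd n : measurable_fun setT (fun wx : sample * R => upd wx.1 n wx.2 : sample).
Proof.
apply: measurable_to_sample => m; rewrite /upd.
have [_|_] := eqVneq m n; first exact: measurable_snd.
exact: (measurableT_comp (measurable_coordinate m) measurable_fst).
Qed.

Lemma upd_comm w i j x y : i != j -> upd (upd w i x) j y = upd (upd w j y) i x.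
Proof.
move=> ij; apply/funext => m; rewrite /upd.
have [->|//] := eqVneq m j; by rewrite eq_sym (negbTE ij).
Qed.

Lemma measurable_upd1 w n : measurable_fun setT (fun x => upd w n x : sample).
Proof.
apply: measurable_to_sample => m; rewrite /upd.
by have [_|_] := eqVneq m n; [exact: measurable_id|exact: measurable_cst].
Qed.

End coordinate_operators.
Arguments sample R : clear implicits.

Section monotone.
Import HBNNSimple.
Context d (T : measurableType d) (R : realType) (mu : {measure set T -> \bar R}).

(* Unlike [ge0_le_integral], no measurability: the integral of a non-negative
   function is a supremum over the simple functions below it. *)
Lemma le_integral_nonmeasurable (f g : T -> \bar R) :
  (forall x, 0 <= f x)%E -> (forall x, f x <= g x)%E ->
  (\int[mu]_x f x <= \int[mu]_x g x)%E.
Proof.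
move=> f0 fg.
rewrite !ge0_integralTE//; last by move=> x; exact: le_trans (fg x).
apply: ereal_sup_le => _ [h hf <-].
by exists h => // x; exact: le_trans (hf x) (fg x).
Qed.

End monotone.

(** * Averaging a function of a sequence over some of its coordinates *)

Section averages.
Context {R : realType} (mu : probability (measurableTypeR R) R).
Local Open Scope ereal_scope.
Implicit Types (f g : sample R -> \bar R) (w : sample R).

(** Conditional expectation given the other coordinates. The result is again a function of a whole
    sequence, constant in coordinate [i], so that the operators compose and can be exchanged. *)
Definition avg (i : nat) f w := \int[mu]_x f (upd w i x).

(* Coordinate [m] is the innermost integration variable. *)
Fixpoint avgs (m r : nat) f : sample R -> \bar R :=
  if r is r'.+1 then avg (m + r') (avgs m r' f) else f.

Lemma avg_ge0 i f : (forall w, 0 <= f w) -> forall w, 0 <= avg i f w.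
Proof. by move=> f0 w; exact: integral_ge0. Qed.

Lemma measurable_avg i f : measurable_fun setT f -> (forall w, 0 <= f w) ->
  measurable_fun setT (avg i f).
Proof.
move=> mf f0.
apply: (measurable_fun_fubini_tonelli_F (fun wx : sample R * measurableTypeR R => f (upd wx.1 i wx.2))) => //.
exact: (measurableT_comp mf (measurable_upd i)).
Qed.

Lemma le_avg i f g w : (forall w, 0 <= f w) -> (forall x, f (upd w i x) <= g (upd w i x)) ->
  avg i f w <= avg i g w.
Proof. by move=> f0 fg; apply: le_integral_nonmeasurable. Qed.

Lemma avg_cst i (c : R) w : avg i (fun=> c%:E) w = c%:E.
Proof.
rewrite /avg integral_cst//.
rewrite [X in _ * X = _](_ : _ = 1%E) ?mule1//; exact: (probability_setT mu).
Qed.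

Lemma avgD i f g w : measurable_fun setT f -> (forall w, 0 <= f w) ->
  measurable_fun setT g -> (forall w, 0 <= g w) ->
  avg i (fun w => f w + g w) w = avg i f w + avg i g w.
Proof.
move=> mf f0 mg g0; rewrite /avg ge0_integralD//.
- exact: (measurableT_comp mf (measurable_upd1 w i)).
- exact: (measurableT_comp mg (measurable_upd1 w i)).
Qed.

Lemma avgZl i (c : R) f w : measurable_fun setT f -> (forall w, 0 <= f w) ->
  (0 <= c)%R -> avg i (fun w => c%:E * f w) w = c%:E * avg i f w.
Proof.
move=> mf f0 c0; rewrite /avg ge0_integralZl_EFin//.
exact: (measurableT_comp mf (measurable_upd1 w i)).
Qed.

Lemma avg_comm i j f w : measurable_fun setT f -> (forall w, 0 <= f w) ->
  avg i (avg j f) w = avg j (avg i f) w.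
Proof.
move=> mf f0; have [->//|ij] := eqVneq i j.
pose F (xy : measurableTypeR R * measurableTypeR R) := f (upd (upd w i xy.1) j xy.2).
have mF : measurable_fun setT F.
  apply: (measurableT_comp mf).
  apply: measurable_to_sample => n; rewrite /upd.
  have [_|_] := eqVneq n j; first exact: measurable_snd.
  have [_|_] := eqVneq n i; first exact: measurable_fst.
  exact: measurable_cst.
have F0 xy : 0 <= F xy by exact: f0.
rewrite [LHS](fubini_tonelli (m1 := mu) (m2 := mu) F mF F0).
by apply: eq_integral => y _; apply: eq_integral => x _; rewrite /F /= upd_comm.
Qed.

Lemma avgs_ge0 m r f : (forall w, 0 <= f w) -> forall w, 0 <= avgs m r f w.
Proof. by move=> f0; elim: r => //= r IH; exact: avg_ge0. Qed.

Lemma measurable_avgs m r f : measurable_fun setT f -> (forall w, 0 <= f w) ->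
  measurable_fun setT (avgs m r f).
Proof.
move=> mf f0; elim: r => //= r IH; apply: measurable_avg => //; exact: avgs_ge0.
Qed.

Lemma le_avgs m r f g w : (forall w, 0 <= f w) -> (forall w, f w <= g w) ->
  avgs m r f w <= avgs m r g w.
Proof.
move=> f0 fg; elim: r w => //= r IH w; apply: le_avg => // w'; exact: avgs_ge0.
Qed.

Lemma avgs_cst m r (c : R) w : avgs m r (fun=> c%:E) w = c%:E.
Proof.
elim: r w => //= r IH w.
by rewrite (_ : avgs _ _ _ = fun=> c%:E) ?avg_cst//; apply/funext.
Qed.

Lemma avgsD m r f g w : measurable_fun setT f -> (forall w, 0 <= f w) ->
  measurable_fun setT g -> (forall w, 0 <= g w) ->
  avgs m r (fun w => f w + g w) w = avgs m r f w + avgs m r g w.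
Proof.
move=> mf f0 mg g0; elim: r w => //= r IH w.
rewrite (_ : avgs _ _ _ = fun w => avgs m r f w + avgs m r g w); last exact/funext.
by rewrite avgD//; [exact: measurable_avgs|exact: avgs_ge0|exact: measurable_avgs|exact: avgs_ge0].
Qed.

Lemma avgsZl m r (c : R) f w : measurable_fun setT f -> (forall w, 0 <= f w) ->
  (0 <= c)%R -> avgs m r (fun w => c%:E * f w) w = c%:E * avgs m r f w.
Proof.
move=> mf f0 c0; elim: r w => //= r IH w.
rewrite (_ : avgs _ _ _ = fun w => c%:E * avgs m r f w); last exact/funext.
by rewrite avgZl//; [exact: measurable_avgs|exact: avgs_ge0].
Qed.

Lemma avgs_cat m r r' f : avgs m (r + r') f = avgs (m + r) r' (avgs m r f).
Proof. by elim: r' => [|r' IH]; rewrite ?addn0// addnS /= IH addnA. Qed.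

Lemma avg_avgs i m r f : measurable_fun setT f -> (forall w, 0 <= f w) ->
  avg i (avgs m r f) = avgs m r (avg i f).
Proof.
move=> mf f0; elim: r => //= r IH; rewrite -IH; apply/funext => w.
by rewrite avg_comm//; [exact: measurable_avgs|exact: avgs_ge0].
Qed.

Lemma avgs_comm m r m' r' f : measurable_fun setT f -> (forall w, 0 <= f w) ->
  avgs m r (avgs m' r' f) = avgs m' r' (avgs m r f).
Proof.
move=> mf f0; elim: r => //= r IH; rewrite IH avg_avgs//.
  exact: measurable_avgs.
exact: avgs_ge0.
Qed.

(** A factor that is constant on the window of averaged coordinates comes out, as in a conditional
    expectation; this is how independence of the users enters later. *)
Lemma avgs_pull m r f (g : sample R -> R) w :
  measurable_fun setT f -> (forall w, 0 <= f w) -> (forall w, 0 <= g w)%R ->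
  (forall w i x, (m <= i < m + r)%N -> g (upd w i x) = g w) ->
  avgs m r (fun w => (g w)%:E * f w) w = (g w)%:E * avgs m r f w.
Proof.
move=> mf f0 g0; elim: r w => //= r IH w gi.
have -> : avgs m r (fun w => (g w)%:E * f w) = fun w => (g w)%:E * avgs m r f w.
  apply/funext => w'; apply: IH => w'' i x /andP[mi im]; apply: gi.
  by rewrite mi addnS ltnS ltnW.
transitivity (avg (m + r) (fun w' => (g w)%:E * avgs m r f w') w).
  apply: eq_integral => x _; rewrite gi//.
  by rewrite leq_addr addnS ltnSn.
by rewrite avgZl//; [exact: measurable_avgs|exact: avgs_ge0].
Qed.

Definition shift (n : nat) (w : nat -> R) : nat -> R := fun m => w (n + m)%N.

Lemma measurable_shift n : measurable_fun setT (shift n : sample R -> sample R).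
Proof. by apply: measurable_to_sample => m; exact: measurable_coordinate. Qed.

Lemma shift_upd n i w x : shift n (upd w (n + i) x) = upd (shift n w) i x.
Proof. by apply/funext => m; rewrite /shift /upd eqn_add2l. Qed.

(** Since the coordinates are identically distributed, an estimate for the first user carries over
    to any other by translation of indices. *)
Lemma avgs_shift n m r f w :
  avgs (n + m) r (fun w => f (shift n w)) w = avgs m r f (shift n w).
Proof.
elim: r w => //= r IH w; apply: eq_integral => x _.
by rewrite IH -addnA shift_upd.
Qed.

End averages.

Section gauss_expect_averages.
Context {R : realType}.
Local Open Scope ereal_scope.

(** Stated for any [w], whose coordinates from [n] on replace the default zeros: in the induction
    the outer variable is stored in [w] before the inner integrals are taken. *)
Lemma avgs_gauss_expect (s : R) n f w :
  avgs (normal_prob 0 s) 0 n f w =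
  gauss_expect s n (fun v => f (fun m => if (m < n)%N then v m else w m)).
Proof.
elim: n w => [|n IH] w //=; apply: eq_integral => x _; rewrite IH.
congr (gauss_expect s n _); apply/funext => v; congr f; apply/funext => m.
rewrite /upd; case: (ltngtP m n) => [mn|mn|->]; last by rewrite ltnSn.
- by rewrite ltnS (ltnW mn).
- by rewrite ltnS leqNgt mn.
Qed.

Lemma gauss_expectE (s : R) n f w :
  (forall v v', (forall m, (m < n)%N -> v m = v' m) -> f v = f v') ->
  gauss_expect s n f = avgs (normal_prob 0 s) 0 n f w.
Proof.
move=> fn; rewrite avgs_gauss_expect; congr (gauss_expect s n _).
by apply/funext => v; apply: fn => m ->.
Qed.

End gauss_expect_averages.

(** * Gaussian estimates *)

Section gaussian_coordinate.
Context {R : realType}.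

(** Each real coordinate carries variance 1/2, half of that of a complex entry; its density is exp(-
    y^2) / sqrt pi. *)
Definition cn_std : R := Num.sqrt (2^-1).
Local Notation mu := (normal_prob 0 cn_std).

Lemma cn_std_neq0 : cn_std != 0.
Proof. by rewrite gt_eqF// sqrtr_gt0 invr_gt0. Qed.

Lemma cn_pdfE (y : R) : normal_pdf 0 cn_std y = (Num.sqrt pi)^-1 * expR (- y ^+ 2).
Proof.
rewrite normal_pdfE ?cn_std_neq0// /normal_peak /normal_fun subr0.
rewrite sqr_sqrtr ?invr_ge0//.
have -> : 2^-1 * pi *+ 2 = pi :> R by lra.
have -> : 2^-1 *+ 2 = 1 :> R by lra.
by rewrite divr1.
Qed.

Lemma sqrt_pi_ge1 : 1 <= Num.sqrt pi :> R.
Proof. by rewrite -[leLHS]sqrtr1 ler_sqrt ?pi_gt0// (le_trans _ (pi_ge2 R))// ler1n. Qed.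

Lemma measurable_cn_pdf (A : set R) :
  measurable_fun A (fun x => (normal_pdf 0 cn_std x)%:E).
Proof.
apply/measurable_EFinP.
apply: measurable_funTS.
exact: measurable_normal_pdf.
Qed.

(** The density never exceeds 1, because sqrt pi >= 1. *)
Lemma cn_prob_le (A : set R) : measurable A -> (mu A <= lebesgue_measure A)%E.
Proof.
move=> mA; rewrite /normal_prob -[leRHS]mul1e -(integral_cst lebesgue_measure mA 1%E).
apply: ge0_le_integral => //.
- by move=> x _; rewrite lee_fin normal_pdf_ge0.
- exact: measurable_cn_pdf.
- move=> x _; rewrite lee_fin cn_pdfE mulr_ile1 ?invr_ge0 ?expR_ge0//.
    by rewrite invf_le1 ?sqrt_pi_ge1// (lt_le_trans ltr01 sqrt_pi_ge1).
  by rewrite -expR0 ler_expR oppr_le0 sqr_ge0.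
Qed.

Lemma cn_prob_itv_le (a b : R) : a <= b -> (mu `[a, b] <= (b - a)%:E)%E.
Proof.
move=> ab; apply: (le_trans (cn_prob_le _)) => //.
by rewrite lebesgue_measure_itv/= lte_fin; case: ltP => _ //; rewrite lee_fin subr_ge0.
Qed.

(* The minimum over [-7, 7] of the density of a coordinate. *)
Definition density_min : R := (Num.sqrt pi)^-1 * expR (- 7 ^+ 2).

Lemma density_min_gt0 : 0 < density_min.
Proof. by rewrite mulr_gt0 ?expR_gt0// invr_gt0 (lt_le_trans ltr01 sqrt_pi_ge1). Qed.

Lemma cn_prob_itv_ge (a b : R) : -7 <= a -> a <= b -> b <= 7 ->
  ((density_min * (b - a))%:E <= mu `[a, b])%E.
Proof.
move=> a7 ab b7.
have -> : (density_min * (b - a))%:E = (\int[lebesgue_measure]_(x in `[a, b]) density_min%:E)%E.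
  rewrite integral_cst//= lebesgue_measure_itv/= lte_fin.
  move: ab; rewrite le_eqVlt => /orP[/eqP->|->]; last by rewrite -EFinD -EFinM.
  by rewrite subrr mulr0 ltxx mule0.
apply: ge0_le_integral => //.
- by move=> x _; rewrite lee_fin (ltW density_min_gt0).
- exact: measurable_cn_pdf.
move=> x /=; rewrite in_itv/= => /andP[ax xb].
rewrite lee_fin cn_pdfE ler_wpM2l ?invr_ge0 ?sqrtr_ge0// ler_expR lerN2.
nra.
Qed.

Lemma measurable_sqr_gt (t : R) : measurable [set y : R | t < y ^+ 2].
Proof.
have m : measurable_fun setT (fun y : R => t < y ^+ 2).
  by apply: measurable_fun_ltr => //; exact: measurable_funX.
have := m measurableT [set true] I; rewrite setTI.
by congr measurable; apply/seteqP; split.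
Qed.

(** On the tail, exp(- y^2) <= exp(- t / 2) exp(- y^2 / 2), so the density is compared with that of
    N(0, 1), whose total mass is 1; the ratio sqrt 2 of the normalising constants is rounded up to
    2. *)
Lemma cn_prob_tail (t : R) : (mu [set y | (t < y ^+ 2)%R] <= (2 * expR (- t / 2))%:E)%E.
Proof.
set A := [set y | _]; have mA : measurable A by exact: measurable_sqr_gt.
have mpdf : measurable_fun setT (fun y : R => (normal_pdf 0 1 y)%:E).
  apply/measurable_EFinP; exact: measurable_normal_pdf.
rewrite -[leRHS]mule1 -(integral_normal_pdf (0 : R) 1).
rewrite -ge0_integralZl_EFin//; last by move=> x _; rewrite lee_fin normal_pdf_ge0.
apply: (@le_trans _ _ (\int[lebesgue_measure]_(x in A) ((2 * expR (- t / 2))%:E * (normal_pdf 0 1 x)%:E))%E).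
  apply: ge0_le_integral => //.
  - by move=> x _; rewrite lee_fin normal_pdf_ge0.
  - exact: measurable_cn_pdf.
  - exact/measurable_funTS/measurable_funeM.
  move=> x /= tx; rewrite lee_fin cn_pdfE normal_pdfE ?oner_neq0//.
  rewrite /normal_peak /normal_fun subr0 expr1n mul1r.
  rewrite mulrACA -expRD ler_pM ?invr_ge0 ?expR_ge0//.
    have := pi_gt0 R; move: pi => p p0.
    have p20 : 0 < p *+ 2 by rewrite pmulrn_lgt0.
    rewrite -ler_pdivrMl// -invfM lef_pV2 ?posrE ?mulr_gt0 ?sqrtr_gt0//.
    rewrite -[leRHS]ger0_norm ?mulr_ge0 ?sqrtr_ge0// -sqrtr_sqr.
    rewrite ler_sqrt ?exprn_gt0 ?mulr_gt0 ?sqrtr_gt0//.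
    by rewrite exprMn sqr_sqrtr ?ltW//; lra.
  rewrite ler_expR; have : t < x ^+ 2 by [].
  by lra.
apply: ge0_subset_integral => //; first exact: measurable_funeM.
by move=> x _; rewrite mule_ge0// lee_fin ?normal_pdf_ge0// mulr_ge0// expR_ge0.
Qed.

Lemma le_avg_itv (f : sample R -> \bar R) i w (a b c : R) : 0 <= c -> a <= b ->
  (forall w, 0 <= f w)%E ->
  (forall x, f (upd w i x) <= (c * (a <= x <= b)%R%:R)%:E)%E ->
  (avg mu i f w <= (c * (b - a))%:E)%E.
Proof.
move=> c0 ab f0 fc.
apply: (@le_trans _ _ (\int[mu]_x (c%:E * (\1_`[a, b] x)%:E))%E).
  apply: le_integral_nonmeasurable => // x; apply: le_trans (fc x) _.
  rewrite -EFinM lee_fin indicE; case: (boolP (a <= x <= b)) => axb.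
    by rewrite mem_set.
  by rewrite mulr0 mulr_ge0.
rewrite ge0_integralZl_EFin//; last exact/measurable_EFinP.
by rewrite integral_indic// setIT EFinM lee_wpmul2l// cn_prob_itv_le.
Qed.

Lemma ge_avg_itv (f : sample R -> \bar R) i w (a b c : R) : 0 <= c ->
  -7 <= a -> a <= b -> b <= 7 ->
  (forall w, 0 <= f w)%E ->
  (forall x, (a <= x <= b)%R -> c%:E <= f (upd w i x))%E ->
  ((c * (density_min * (b - a)))%:E <= avg mu i f w)%E.
Proof.
move=> c0 a7 ab b7 f0 fc.
apply: (@le_trans _ _ (\int[mu]_x (c%:E * (\1_`[a, b] x)%:E))%E); last first.
  apply: le_integral_nonmeasurable => // x; rewrite indicE.
    by rewrite -EFinM lee_fin mulr_ge0.
  have [/set_mem/=|_] := boolP (x \in _); last by rewrite mule0.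
  by rewrite in_itv/= mule1 => /fc.
rewrite ge0_integralZl_EFin//; last exact/measurable_EFinP.
by rewrite integral_indic// setIT EFinM lee_wpmul2l// cn_prob_itv_ge.
Qed.

Lemma avg_tail_le (i : nat) (w : sample R) (t : R) :
  (avg mu i (fun w => ((t < w i ^+ 2)%R%:R)%:E) w <= (2 * expR (- t / 2))%:E)%E.
Proof.
apply: le_trans (cn_prob_tail t).
rewrite -[leRHS](_ : \int[mu]_x (\1_[set y | (t < y ^+ 2)%R] x)%:E = _)%E; last first.
  by rewrite integral_indic ?setIT//; exact: measurable_sqr_gt.
by apply: le_integral_nonmeasurable => x; rewrite ?lee_fin// indicE /upd eqxx mem_setE.
Qed.

End gaussian_coordinate.

(** * Integration over one complex vector, that is, four real coordinates *)

Section block_estimates.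
Context {R : realType}.
Local Notation mu := (normal_prob (0 : R) cn_std).
Implicit Types (f : sample R -> \bar R) (w : sample R).

(* |v0 b1 - v1 b0|^2 for v = (x0 + i x1, x2 + i x3), b = (y0 + i y1, y2 + i y3) *)
Definition det_sqr (x0 x1 x2 x3 y0 y1 y2 y3 : R) : R :=
  (x0 * y2 - x1 * y3 - (x2 * y0 - x3 * y1)) ^+ 2 +
  (x0 * y3 + x1 * y2 - (x2 * y1 + x3 * y0)) ^+ 2.

Lemma det_sqr_swap x0 x1 x2 x3 y0 y1 y2 y3 :
  det_sqr x0 x1 x2 x3 y0 y1 y2 y3 = det_sqr x2 x3 x0 x1 y2 y3 y0 y1.
Proof. by rewrite /det_sqr; ring. Qed.

Lemma det_sqrC x0 x1 x2 x3 y0 y1 y2 y3 :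
  det_sqr x0 x1 x2 x3 y0 y1 y2 y3 = det_sqr y0 y1 y2 y3 x0 x1 x2 x3.
Proof. by rewrite /det_sqr; ring. Qed.

(* [c1 + i c2] is the complex quotient [(x2 + i x3) (y0 + i y1) / (y2 + i y3)]. *)
Lemma det_sqr_center x2 x3 y0 y1 y2 y3 : 0 < y2 ^+ 2 + y3 ^+ 2 ->
  exists c : R * R,
    (forall x0 x1, det_sqr x0 x1 x2 x3 y0 y1 y2 y3 =
      ((x0 - c.1) ^+ 2 + (x1 - c.2) ^+ 2) * (y2 ^+ 2 + y3 ^+ 2)) /\
    (c.1 ^+ 2 + c.2 ^+ 2) * (y2 ^+ 2 + y3 ^+ 2) =
      (x2 ^+ 2 + x3 ^+ 2) * (y0 ^+ 2 + y1 ^+ 2).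
Proof.
move=> y0'; pose s := x2 * y0 - x3 * y1; pose t := x2 * y1 + x3 * y0.
have yn0 : y2 ^+ 2 + y3 ^+ 2 != 0 by rewrite gt_eqF.
exists ((s * y2 + t * y3) / (y2 ^+ 2 + y3 ^+ 2), (t * y2 - s * y3) / (y2 ^+ 2 + y3 ^+ 2)).
split => [x0 x1|]; rewrite /det_sqr /s /t /=; field; exact: yn0.
Qed.

(** The square of half-side [r] stands for the disc it encloses: it factors into two intervals, each
    of probability at most 2 * r. *)
Lemma avgs2_le m f w (c1 c2 r v : R) : (forall w, 0 <= f w)%E -> 0 <= r -> 0 <= v ->
  (forall x0 x1, (f (upd (upd w (m + 1) x1) (m + 0) x0) <=
     (v * ((c1 - r <= x0 <= c1 + r) && (c2 - r <= x1 <= c2 + r))%R%:R)%:E)%E) ->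
  (avgs mu m 2 f w <= (v * (2 * r) ^+ 2)%:E)%E.
Proof.
move=> f0 r0 v0 fc.
rewrite (_ : v * (2 * r) ^+ 2 = v * ((c1 + r) - (c1 - r)) * ((c2 + r) - (c2 - r))); last by ring.
have le1 (c : R) : c - r <= c + r by lra.
rewrite /=; apply: le_avg_itv => //.
- by rewrite mulr_ge0// subr_ge0.
- exact: avg_ge0.
move=> x1; rewrite mulrAC; apply: le_avg_itv => //; first by rewrite mulr_ge0.
move=> x0; apply: le_trans (fc _ _) _; rewrite lee_fin.
by case: (_ <= x0 <= _); case: (_ <= x1 <= _); rewrite /= ?mulr1 ?mulr0.
Qed.

Lemma avgs2_ge m f w (a1 b1 a2 b2 v : R) : (forall w, 0 <= f w)%E -> 0 <= v ->
  -7 <= a1 -> a1 <= b1 -> b1 <= 7 -> -7 <= a2 -> a2 <= b2 -> b2 <= 7 ->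
  (forall x0 x1, a1 <= x0 <= b1 -> a2 <= x1 <= b2 ->
     (v%:E <= f (upd (upd w (m + 1) x1) (m + 0) x0))%E) ->
  ((v * (density_min * (b1 - a1)) * (density_min * (b2 - a2)))%:E <= avgs mu m 2 f w)%E.
Proof.
move=> f0 v0 a17 ab1 b17 a27 ab2 b27 fc /=.
have d0 := ltW (@density_min_gt0 R).
apply: ge_avg_itv => //; [by rewrite !mulr_ge0 ?subr_ge0|exact: avg_ge0|].
move=> x1 x1i; apply: ge_avg_itv => // x0 x0i; exact: fc.
Qed.

(** Pointwise hypotheses are asked only for sequences obtained from [w] by changing the averaged
    window; the coordinates outside stay frozen, which is how conditioning is expressed. *)
Definition agree_off (m r : nat) (w w' : nat -> R) :=
  forall i, ~~ (m <= i < m + r)%N -> w' i = w i.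

Lemma agree_off_upd m r w w' i x :
  (m <= i < m + r)%N -> agree_off m r w w' -> agree_off m r w (upd w' i x).
Proof.
move=> mi ww' j mj; rewrite /upd; case: eqP => [ji|_]; last exact: ww'.
by move: mj; rewrite ji mi.
Qed.

Lemma agree_off_refl m r w : agree_off m r w w. Proof. by []. Qed.

Lemma agree_off_sub m r m' r' w w' w'' : (m' <= m)%N -> (m + r <= m' + r')%N ->
  agree_off m' r' w w' -> agree_off m r w' w'' -> agree_off m' r' w w''.
Proof.
move=> mm rr a1 a2 i hi; rewrite a2 ?a1//; apply: contra hi => /andP[h1 h2].
by rewrite (leq_trans mm h1) (leq_trans h2 rr).
Qed.

Lemma avgs_le m r f w (c : R) : (forall w, 0 <= f w)%E ->
  (forall w', agree_off m r w w' -> (f w' <= c%:E)%E) -> (avgs mu m r f w <= c%:E)%E.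
Proof.
move=> f0; elim: r w => [|r IH] w fc /=; first exact: fc.
rewrite -(@avg_cst _ mu (m + r) c w); apply: le_avg => [w'|x]; first exact: avgs_ge0.
apply: IH => w' aw'; apply: fc; apply: agree_off_sub aw' => //.
  by rewrite addnS.
by apply: agree_off_upd => //; rewrite leq_addr addnS /=.
Qed.

Lemma avgs_ge m r f w (c : R) : 0 <= c ->
  (forall w', agree_off m r w w' -> (c%:E <= f w')%E) -> (c%:E <= avgs mu m r f w)%E.
Proof.
move=> c0; elim: r w => [|r IH] w fc /=; first exact: fc.
rewrite -[leLHS](@avg_cst _ mu (m + r) c w); apply: le_avg => [w'|x]; first by rewrite lee_fin.
apply: IH => w' aw'; apply: fc; apply: agree_off_sub aw' => //.
  by rewrite addnS.
by apply: agree_off_upd => //; rewrite leq_addr addnS /=.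
Qed.

Lemma sqr_le_itv (c x r : R) : 0 <= r -> (x - c) ^+ 2 <= r ^+ 2 -> c - r <= x <= c + r.
Proof. by move=> r0 h; apply/andP; split; nra. Qed.

Lemma avgs4_split m f : measurable_fun setT f -> (forall w, 0 <= f w)%E ->
  avgs mu m 4 f = avgs mu m 2 (avgs mu (m + 2) 2 f).
Proof. by move=> mf f0; rewrite (avgs_cat mu m 2 2) avgs_comm. Qed.

(* For a fixed vector y, |det(v, y)|^2 < rho |y|^2 confines one complex coordinate of v
   to a disc of squared radius 2 rho: divide by the larger component of y. *)
Lemma block_le m f w (rho v y0 y1 y2 y3 : R) :
  measurable_fun setT f -> (forall w, 0 <= f w)%E -> 0 <= rho -> 0 <= v ->
  (forall w', agree_off m 4 w w' ->
     (f w' <= (v * (det_sqr (w' (m + 0)%N) (w' (m + 1)%N) (w' (m + 2)%N) (w' (m + 3)%N) y0 y1 y2 y3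
           < rho * (y0 ^+ 2 + y1 ^+ 2 + y2 ^+ 2 + y3 ^+ 2))%R%:R)%:E)%E) ->
  (avgs mu m 4 f w <= (8 * rho * v)%:E)%E.
Proof.
move=> mf f0 rho0 v0 fle; set n := (X in rho * X) in fle.
pose r := Num.sqrt (2 * rho).
have r0 : 0 <= r by exact: sqrtr_ge0.
have r2 : r ^+ 2 = 2 * rho by rewrite sqr_sqrtr ?mulr_ge0.
have -> : 8 * rho * v = v * (2 * r) ^+ 2 by rewrite exprMn r2; ring.
have [n0|n0] := leP n 0.
  apply: avgs_le => // w' /fle/le_trans; apply.
  rewrite lee_fin ltNge (le_trans (mulr_ge0_le0 rho0 n0)) ?mulr0 ?mulr_ge0 ?sqr_ge0//.
  by rewrite addr_ge0 ?sqr_ge0.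
have itv N D (c1 c2 x0 x1 : R) : n <= 2 * N -> 0 < N ->
  D = ((x0 - c1) ^+ 2 + (x1 - c2) ^+ 2) * N -> D < rho * n ->
  (c1 - r <= x0 <= c1 + r) && (c2 - r <= x1 <= c2 + r).
  move=> nN N0 -> h.
  have {}h : (x0 - c1) ^+ 2 + (x1 - c2) ^+ 2 <= 2 * rho.
    rewrite -(ler_pM2r N0); apply: le_trans (ltW h) _.
    by rewrite [2 * rho]mulrC -mulrA ler_wpM2l.
  have s0 := sqr_ge0 (x0 - c1); have s1 := sqr_ge0 (x1 - c2).
  by apply/andP; split; apply: sqr_le_itv => //; rewrite r2; lra.
have [big|small] := leP n (2 * (y2 ^+ 2 + y3 ^+ 2)).
- rewrite (avgs_cat mu m 2 2); apply: avgs_le => [w'|w1 aw1]; first exact: avgs_ge0.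
  have N0 : 0 < y2 ^+ 2 + y3 ^+ 2 by lra.
  have [[c1 c2] [/= cE _]] := det_sqr_center (w1 (m + 2)%N) (w1 (m + 3)%N) y0 y1 N0.
  apply: (@avgs2_le _ _ _ c1 c2) => // x0 x1.
  apply: le_trans (fle _ _) _.
    apply: agree_off_upd; first by rewrite leq_addr ltn_add2l.
    apply: agree_off_upd; first by rewrite leq_addr ltn_add2l.
    by apply: agree_off_sub aw1 => //; rewrite -?addnA ?leq_addr.
  rewrite lee_fin ler_wpM2l// ler_nat /upd !eqn_add2l/=.
  by case: ltP => // h; rewrite (itv _ _ _ _ _ _ big N0 (cE _ _) h).
(* The second component of the fixed vector is too small to divide by, so the first
   component of the block is integrated out last. *)
rewrite avgs4_split//; apply: avgs_le => [w'|w1 aw1]; first exact: avgs_ge0.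
have nE : n = y0 ^+ 2 + y1 ^+ 2 + y2 ^+ 2 + y3 ^+ 2 by [].
have N0 : 0 < y0 ^+ 2 + y1 ^+ 2 by lra.
have big : n <= 2 * (y0 ^+ 2 + y1 ^+ 2) by lra.
have [[c1 c2] [/= cE _]] := det_sqr_center (w1 (m + 0)%N) (w1 (m + 1)%N) y2 y3 N0.
apply: (@avgs2_le _ _ _ c1 c2) => // x0 x1.
apply: le_trans (fle _ _) _.
  apply: agree_off_upd; first by rewrite -!addnA leq_addr ltn_add2l.
  apply: agree_off_upd; first by rewrite -!addnA leq_addr ltn_add2l.
  by apply: agree_off_sub aw1 => //; rewrite leq_add2l.
rewrite lee_fin ler_wpM2l// ler_nat /upd -!addnA !eqn_add2l/=.
by rewrite det_sqr_swap; case: ltP => // h; rewrite (itv _ _ _ _ _ _ big N0 (cE _ _) h).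
Qed.

(* Components in [1, 2] keep the centre given by [det_sqr_center] within [-6, 6],
   hence the interval of half-width [sqrt x] around it within [-7, 7]. *)
Lemma block_ge m f w (x v y0 y1 y2 y3 : R) :
  measurable_fun setT f -> (forall w, 0 <= f w)%E -> 0 < x <= 1 -> 0 <= v ->
  1 <= y0 <= 2 -> 1 <= y1 <= 2 -> 1 <= y2 <= 2 -> 1 <= y3 <= 2 ->
  (forall w', agree_off m 4 w w' ->
     det_sqr (w' (m + 0)%N) (w' (m + 1)%N) (w' (m + 2)%N) (w' (m + 3)%N) y0 y1 y2 y3
        < x * (w' (m + 0)%N ^+ 2 + w' (m + 1)%N ^+ 2 + w' (m + 2)%N ^+ 2 + w' (m + 3)%N ^+ 2)
            * (y0 ^+ 2 + y1 ^+ 2 + y2 ^+ 2 + y3 ^+ 2) ->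
     (v%:E <= f w')%E) ->
  ((4 * density_min ^+ 4 * x * v)%:E <= avgs mu m 4 f w)%E.
Proof.
move=> mf f0 /andP[x0 x1] v0 /andP[y01 y02] /andP[y11 y12] /andP[y21 y22] /andP[y31 y32] fge.
pose r := Num.sqrt x.
have r0 : 0 <= r by exact: sqrtr_ge0.
have r2 : r ^+ 2 = x by rewrite sqr_sqrtr// ltW.
have r1 : r <= 1 by rewrite -sqrtr1 ler_sqrt.
have d0 := @density_min_gt0 R.
pose u : R := v * (density_min * (2 * r)) * (density_min * (2 * r)).
have u0 : 0 <= u by rewrite !mulr_ge0// ltW.
have -> : 4 * density_min ^+ 4 * x * v = u * (density_min * (2 - 1)) * (density_min * (2 - 1)).
  by rewrite /u -r2; ring.
rewrite (avgs_cat mu m 2 2); apply: avgs2_ge => //; try by lra.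
  exact: avgs_ge0.
move=> x2 x3 /andP[x21 x22] /andP[x31 x32].
set w1 := upd _ _ _.
have N0 : 0 < y2 ^+ 2 + y3 ^+ 2 by nra.
have [[c1 c2] [/= cE cB]] := det_sqr_center x2 x3 y0 y1 N0.
(* The squared modulus of the centre is at most 8 * 8 / 2 = 32, rounded up to 6^2. *)
have cb : c1 ^+ 2 + c2 ^+ 2 <= 36.
  rewrite -(ler_pM2r N0) cB.
  have : x2 ^+ 2 + x3 ^+ 2 <= 8 by nra.
  have : y0 ^+ 2 + y1 ^+ 2 <= 8 by nra.
  have : 2 <= y2 ^+ 2 + y3 ^+ 2 by nra.
  have := sqr_ge0 x2; have := sqr_ge0 x3; have := sqr_ge0 y0; have := sqr_ge0 y1.
  nra.
have /andP[c11 c12] : 0 - 6 <= c1 <= 0 + 6.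
  by apply: sqr_le_itv => //; rewrite subr0; have := sqr_ge0 c2; lra.
have /andP[c21 c22] : 0 - 6 <= c2 <= 0 + 6.
  by apply: sqr_le_itv => //; rewrite subr0; have := sqr_ge0 c1; lra.
rewrite /u; have -> : 2 * r = c1 + r - (c1 - r) by ring.
have {2}-> : c1 + r - (c1 - r) = c2 + r - (c2 - r) by ring.
apply: avgs2_ge => //; try by lra.
move=> z0 z1 /andP[z01 z02] /andP[z11 z12]; apply: fge.
  apply: agree_off_upd; first by rewrite leq_addr ltn_add2l.
  apply: agree_off_upd; first by rewrite leq_addr ltn_add2l.
  apply: agree_off_upd; first by rewrite -!addnA leq_addr ltn_add2l.
  apply: agree_off_upd; first by rewrite -!addnA leq_addr ltn_add2l.
  exact: agree_off_refl.
rewrite /w1 /upd -!addnA !eqn_add2l/= cE.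
have itv_sqr (z c : R) : c - r <= z -> z <= c + r -> (z - c) ^+ 2 <= x.
  by move=> lo hi; rewrite -r2; nra.
have h0 := itv_sqr _ _ z01 z02; have h1 := itv_sqr _ _ z11 z12.
(* The determinant is at most 2 x N on the square; N < M since y0 and y1 are positive, and the
   vector being integrated has squared norm at least 2. *)
set N := y2 ^+ 2 + y3 ^+ 2 in N0 *; set M := _ + y3 ^+ 2.
have NM : N < M by rewrite /N /M; nra.
have s2 : 2 <= z0 ^+ 2 + z1 ^+ 2 + x2 ^+ 2 + x3 ^+ 2.
  by have := sqr_ge0 z0; have := sqr_ge0 z1; nra.
apply: (@le_lt_trans _ _ (x * 2 * N)).
  by apply: ler_wpM2r; [exact: ltW|lra].
apply: (@lt_le_trans _ _ (x * 2 * M)); first by rewrite ltr_pM2l ?mulr_gt0.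
apply: ler_wpM2r; first exact: ltW (lt_trans N0 NM).
by apply: ler_wpM2l => //; exact: ltW.
Qed.

End block_estimates.

(** * Aligned and bad users *)

Section events.
Context {R : realType}.
Local Notation mu := (normal_prob (0 : R) cn_std).
Implicit Types (b : sample R -> bool) (w : sample R).

Definition ind b w : \bar R := ((b w)%:R)%:E.

Lemma ind_ge0 b w : (0 <= ind b w)%E.
Proof. by rewrite lee_fin ler0n. Qed.

Lemma measurable_ind b : measurable_fun setT b -> measurable_fun setT (ind b).
Proof.
move=> mb; apply/measurable_EFinP; exact: (measurableT_comp (f := fun c : bool => c%:R : R)).
Qed.

Lemma measurable_not b : measurable_fun setT b -> measurable_fun setT (fun w => ~~ b w).
Proof. exact: (measurableT_comp (f := negb)). Qed.

Lemma measurable_orb b b' : measurable_fun setT b -> measurable_fun setT b' ->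
  measurable_fun setT (fun w => b w || b' w).
Proof.
move=> mb mb'; rewrite (_ : (fun w => _) = fun w => ~~ (~~ b w && ~~ b' w)).
  by apply: measurable_not; apply: measurable_and; exact: measurable_not.
by apply/funext => w; rewrite negb_and !negbK.
Qed.

Lemma le_ind b b' w : (b w -> b' w) -> (ind b w <= ind b' w)%E.
Proof. by rewrite lee_fin ler_nat; case: (b w) => // ->. Qed.

Lemma avgs_or_le m r b b' w (c c' : R) : measurable_fun setT b -> measurable_fun setT b' ->
  (avgs mu m r (ind b) w <= c%:E)%E -> (avgs mu m r (ind b') w <= c'%:E)%E ->
  (avgs mu m r (ind (fun w => b w || b' w)) w <= (c + c')%:E)%E.
Proof.
move=> mb mb' bc bc'; rewrite EFinD; apply: le_trans (leeD bc bc').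
rewrite -avgsD; [|exact: measurable_ind|exact: ind_ge0|exact: measurable_ind|exact: ind_ge0].
apply: le_avgs => [w'|w']; first exact: ind_ge0.
by rewrite lee_fin -natrD ler_nat; case: (b w'); case: (b' w').
Qed.

Lemma avgs_not b m r w : measurable_fun setT b ->
  (avgs mu m r (ind b) w + avgs mu m r (ind (fun w => ~~ b w)) w = 1)%E.
Proof.
move=> mb; rewrite -avgsD; [|exact: measurable_ind|exact: ind_ge0| |exact: ind_ge0].
  rewrite -[RHS](avgs_cst mu m r 1 w); congr avgs; apply/funext => w'.
  by rewrite /ind -EFinD -natrD; case: (b w').
apply: measurable_ind; exact: measurable_not.
Qed.

(** Splitting the window just after [i] exposes the average over [i], which is moved innermost by
    commutation; the other averages preserve a constant bound. *)
Lemma avgs_avg_le m r i f w (c : R) : (m <= i < m + r)%N ->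
  measurable_fun setT f -> (forall w, 0 <= f w)%E ->
  (forall w, avg mu i f w <= c%:E)%E -> (avgs mu m r f w <= c%:E)%E.
Proof.
move=> /andP[mi ir] mf f0 fc.
have -> : r = ((i - m).+1 + (m + r - i.+1))%N by lia.
rewrite avgs_cat; apply: avgs_le => [w'|w' _]; first exact: avgs_ge0.
rewrite /= subnKC// avg_avgs//; apply: avgs_le => // w''; exact: avg_ge0.
Qed.

(** Within the 12 coordinates of one user, channel [j] occupies the four starting at 4 * j: real and
    imaginary parts of its two entries in turn. *)
Definition nrm_sqr (j : nat) w : R :=
  w (4 * j + 0)%N ^+ 2 + w (4 * j + 1)%N ^+ 2 + w (4 * j + 2)%N ^+ 2 + w (4 * j + 3)%N ^+ 2.

Definition pair_det (j k : nat) w : R :=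
  det_sqr (w (4 * j + 0)%N) (w (4 * j + 1)%N) (w (4 * j + 2)%N) (w (4 * j + 3)%N)
          (w (4 * k + 0)%N) (w (4 * k + 1)%N) (w (4 * k + 2)%N) (w (4 * k + 3)%N).

Lemma measurable_nrm_sqr j : measurable_fun setT (nrm_sqr j).
Proof.
by do !apply: measurable_funD; apply: measurable_funX; exact: measurable_coordinate.
Qed.

Lemma measurable_pair_det j k : measurable_fun setT (pair_det j k).
Proof.
have mM i i' : measurable_fun setT (fun w : sample R => w i * w i').
  by apply: measurable_funM; exact: measurable_coordinate.
apply: measurable_funD; apply: measurable_funX; apply: measurable_funB.
- by apply: measurable_funB; exact: mM.
- by apply: measurable_funB; exact: mM.
- by apply: measurable_funD; exact: mM.
- by apply: measurable_funD; exact: mM.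
Qed.

Lemma nrm_sqr_ge0 j w : 0 <= nrm_sqr j w.
Proof. by rewrite !addr_ge0 ?sqr_ge0. Qed.

Definition null_vec j w : bool := nrm_sqr j w == 0.
Definition large_vec (M : R) j w : bool := M < nrm_sqr j w.
(** The metric condition D < x cleared of denominators; it fails when either vector vanishes. *)
Definition aligned (x : R) j k w : bool := pair_det j k w < x * nrm_sqr j w * nrm_sqr k w.
(** For a nonzero [k]-th vector, [pair_det] over its squared norm is the squared distance of the
    [j]-th vector from the complex line it spans. *)
Definition close_to (rho : R) j k w : bool := pair_det j k w < rho * nrm_sqr k w.

Lemma measurable_null_vec j : measurable_fun setT (null_vec j).
Proof. by apply: measurable_fun_eqr => //; exact: measurable_nrm_sqr. Qed.

Lemma measurable_large_vec M j : measurable_fun setT (large_vec M j).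
Proof. by apply: measurable_fun_ltr => //; exact: measurable_nrm_sqr. Qed.

Lemma measurable_aligned x j k : measurable_fun setT (aligned x j k).
Proof.
apply: measurable_fun_ltr; first exact: measurable_pair_det.
apply: measurable_funM; last exact: measurable_nrm_sqr.
by apply: measurable_funM => //; exact: measurable_nrm_sqr.
Qed.

Lemma measurable_close_to rho j k : measurable_fun setT (close_to rho j k).
Proof.
apply: measurable_fun_ltr; first exact: measurable_pair_det.
by apply: measurable_funM => //; exact: measurable_nrm_sqr.
Qed.

(** A zero vector confines its first coordinate to the degenerate interval [0, 0]. *)
Lemma avgs_null_le j w : (j < 3)%N -> (avgs mu 0 12 (ind (null_vec j)) w <= 0)%E.
Proof.
move=> j3; have mb := measurable_null_vec j.
apply: (@avgs_avg_le _ _ (4 * j + 0)).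
- by lia.
- exact: measurable_ind.
- exact: ind_ge0.
move=> w'; rewrite -[leRHS](_ : (1 * (0 - 0))%:E = _); last by rewrite subrr mulr0.
apply: le_avg_itv => //; first exact: ind_ge0.
move=> x; rewrite mul1r lee_fin ler_nat /null_vec /nrm_sqr /upd eqxx !eqn_add2l/=.
case: eqP => // s0; suff -> : x = 0 by rewrite lexx.
move: s0; set a := w' _; set a' := w' _; set a'' := w' _ => s0.
have := sqr_ge0 a; have := sqr_ge0 a'; have := sqr_ge0 a''; have := sqr_ge0 x => h1 h2 h3 h4.
by apply/eqP; rewrite -sqrf_eq0; apply/eqP; lra.
Qed.

(** By pigeonhole one of the four squares exceeds M / 4; the union bound then gives four tails. *)
Lemma avgs_large_le j w (M : R) : (j < 3)%N ->
  (avgs mu 0 12 (ind (large_vec M j)) w <= (8 * expR (- M / 8))%:E)%E.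
Proof.
move=> j3; have mT (T : R) i : measurable_fun setT (fun w : sample R => T < w i ^+ 2).
  by apply: measurable_fun_ltr => //; apply: measurable_funX; exact: measurable_coordinate.
pose big i (w : sample R) := M / 4 < w i ^+ 2.
have one i : (i < 4)%N -> (avgs mu 0 12 (ind (big (4 * j + i)%N)) w <= (2 * expR (- M / 8))%:E)%E.
  move=> i4; apply: (@avgs_avg_le _ _ (4 * j + i)).
  - by lia.
  - by apply: measurable_ind; exact: mT.
  - exact: ind_ge0.
  move=> w'; apply: le_trans (avg_tail_le _ _ _) _.
  by rewrite (_ : - (M / 4) / 2 = - M / 8)//; lra.
have mb i : measurable_fun setT (big i) by exact: mT.
have := avgs_or_le (measurable_orb (measurable_orb (mb _) (mb _)) (mb _)) (mb _)
 (avgs_or_le (measurable_orb (mb _) (mb _)) (mb _)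
  (avgs_or_le (mb _) (mb _) (one 0%N isT) (one 1%N isT)) (one 2%N isT)) (one 3%N isT).
rewrite (_ : _ + _ = 8 * expR (- M / 8)); last by ring.
apply: le_trans; apply: le_avgs => [w'|w']; first exact: ind_ge0.
apply: le_ind; rewrite /large_vec /nrm_sqr /big.
do 4 (case: ltP => //= ?); lra.
Qed.

Section roles.
(* Index of the desired channel and of the two interfering ones. *)
Variables (h p q : nat).
Hypotheses (h3 : (h < 3)%N) (p3 : (p < 3)%N) (q3 : (q < 3)%N).
Hypotheses (hp : h != p) (hq : h != q) (pq : p != q).

Lemma agree_off_block j k w w' i : j != k -> (i < 4)%N -> agree_off (4 * j) 4 w w' ->
  w' (4 * k + i)%N = w (4 * k + i)%N.
Proof.
by move=> jk i4; apply; lia.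
Qed.

(** By Tonelli the desired channel can be integrated innermost and the common reference [p]
    outermost, whatever the indices. Exchanging the outer or the inner pair of blocks reaches all
    six orders. *)
Lemma avgs12E f : measurable_fun setT f -> (forall w, 0 <= f w)%E ->
  avgs mu 0 12 f = avgs mu (4 * p) 4 (avgs mu (4 * q) 4 (avgs mu (4 * h) 4 f)).
Proof.
move=> mf f0.
have B0 j := avgs_ge0 mu (4 * j) 4 f0.
have mB j := measurable_avgs mu (4 * j) 4 mf f0.
pose B j g := avgs mu (4 * j) 4 g.
have dec : avgs mu 0 12 f = B 2%N (B 1%N (B 0%N f)).
  by rewrite (avgs_cat mu 0 4 8) (avgs_cat mu (0 + 4) 4 4).
have swap_out j k l : B j (B k (B l f)) = B k (B j (B l f)).
  exact: (avgs_comm mu (4 * j) 4 (4 * k) 4 (mB l) (B0 l)).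
have swap_in j k l : B j (B k (B l f)) = B j (B l (B k f)).
  exact: (f_equal (B j) (avgs_comm mu (4 * k) 4 (4 * l) 4 mf f0)).
rewrite -![avgs mu (4 * _) 4 _]/(B _ _) dec; clear dec mB B0; clearbody B.
have : (p = 0 /\ q = 1 /\ h = 2 \/ p = 0 /\ q = 2 /\ h = 1 \/
  p = 1 /\ q = 0 /\ h = 2 \/ p = 1 /\ q = 2 /\ h = 0 \/
  p = 2 /\ q = 0 /\ h = 1 \/ p = 2 /\ q = 1 /\ h = 0)%N by lia.
have s210 := swap_in 2%N 1%N 0%N; have o210 := swap_out 2%N 1%N 0%N.
have o201 := swap_out 2%N 0%N 1%N; have s021 := swap_in 0%N 2%N 1%N.
have s120 := swap_in 1%N 2%N 0%N.
case=> [[-> [-> ->]]|]; first by rewrite s210 o201 s021.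
case=> [[-> [-> ->]]|]; first by rewrite s210 o201.
case=> [[-> [-> ->]]|]; first by rewrite o210 s120.
case=> [[-> [-> ->]]|]; first by rewrite o210.
by case=> [[-> [-> ->]]|[-> [-> ->]]].
Qed.

Lemma nrm_sqr_agree j k w w' : j != k -> agree_off (4 * j) 4 w w' -> nrm_sqr k w' = nrm_sqr k w.
Proof. by move=> jk aw; rewrite /nrm_sqr !(agree_off_block jk _ aw). Qed.

Lemma pair_det_agree j k l w w' : j != k -> j != l -> agree_off (4 * j) 4 w w' ->
  pair_det k l w' = pair_det k l w.
Proof. by move=> jk jl aw; rewrite /pair_det !(agree_off_block jk _ aw, agree_off_block jl _ aw). Qed.

(** Given p, integrating over h leaves 8 * rho' times the indicator of the event on q, which is
    frozen there; integrating over q contributes 8 * rho. The bound is uniform in p. *)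
Lemma avgs_close_le (rho rho' : R) w : 0 <= rho -> 0 <= rho' ->
  (avgs mu 0 12 (ind (fun w => close_to rho q p w && close_to rho' h p w)) w
    <= (64 * rho * rho')%:E)%E.
Proof.
move=> r0 r0'; set b := (fun w => _).
have mb : measurable_fun setT b.
  by apply: measurable_and; exact: measurable_close_to.
have mi := measurable_ind mb; have i0 := ind_ge0 b.
have mh := measurable_avgs mu (4 * h) 4 mi i0.
have h0 := avgs_ge0 mu (4 * h) 4 i0.
rewrite avgs12E//; apply: avgs_le => [w'|w1 _]; first exact: avgs_ge0.
have -> : 64 * rho * rho' = 8 * rho * (8 * rho') by ring.
apply: (@block_le _ _ _ _ _ _ (w1 (4 * p + 0)%N) (w1 (4 * p + 1)%N) (w1 (4 * p + 2)%N) (w1 (4 * p + 3)%N)) => //.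
  by rewrite mulr_ge0.
move=> w2 aw2.
have qp : q != p by rewrite eq_sym.
have <- : close_to rho q p w2 = (det_sqr (w2 (4 * q + 0)%N) (w2 (4 * q + 1)%N)
   (w2 (4 * q + 2)%N) (w2 (4 * q + 3)%N) (w1 (4 * p + 0)%N) (w1 (4 * p + 1)%N)
   (w1 (4 * p + 2)%N) (w1 (4 * p + 3)%N) < rho * nrm_sqr p w1).
  by rewrite /close_to /pair_det (nrm_sqr_agree qp aw2) !(agree_off_block qp _ aw2).
apply: (@block_le _ _ _ _ _ _ (w2 (4 * p + 0)%N) (w2 (4 * p + 1)%N) (w2 (4 * p + 2)%N) (w2 (4 * p + 3)%N)) => //.
move=> w3 aw3; rewrite /ind /b lee_fin -natrM ler_nat mulnb.
have -> : close_to rho q p w3 = close_to rho q p w2.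
  by rewrite /close_to (pair_det_agree hq hp aw3) (nrm_sqr_agree hp aw3).
have -> // : close_to rho' h p w3 = (det_sqr (w3 (4 * h + 0)%N) (w3 (4 * h + 1)%N)
   (w3 (4 * h + 2)%N) (w3 (4 * h + 3)%N) (w2 (4 * p + 0)%N) (w2 (4 * p + 1)%N)
   (w2 (4 * p + 2)%N) (w2 (4 * p + 3)%N) < rho' * nrm_sqr p w2).
by rewrite /close_to /pair_det /nrm_sqr !(agree_off_block hp _ aw3).
Qed.

(** The four coordinates of p lie in [1, 2] with probability at least [density_min ^+ 4]; [block_ge]
    over q then supplies the factor linear in x, and the average over h is trivial because the event
    ignores h. *)
Lemma avgs_aligned_ge (x : R) w : 0 < x <= 1 ->
  ((4 * density_min ^+ 8 * x)%:E <= avgs mu 0 12 (ind (aligned x q p)) w)%E.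
Proof.
move=> x01; have /andP[x0 x1] := x01.
have mi := measurable_ind (measurable_aligned x q p); have i0 := ind_ge0 (aligned x q p).
have mh := measurable_avgs mu (4 * h) 4 mi i0.
have h0 := avgs_ge0 mu (4 * h) 4 i0.
have mq := measurable_avgs mu (4 * q) 4 mh h0.
have q0 := avgs_ge0 mu (4 * q) 4 h0.
have d0 := ltW (@density_min_gt0 R).
pose v : R := 4 * density_min ^+ 4 * x * 1.
have v0 : 0 <= v by rewrite !mulr_ge0// ?exprn_ge0// ltW.
rewrite avgs12E// (avgs_cat mu (4 * p) 2 2).
rewrite (_ : 4 * density_min ^+ 8 * x =
  v * (density_min * (2 - 1)) * (density_min * (2 - 1)) * (density_min * (2 - 1)) * (density_min * (2 - 1))); last first.
  by rewrite /v; ring.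
apply: avgs2_ge; try lra; [exact: avgs_ge0|by rewrite !mulr_ge0//; lra|].
move=> x2 x3 /andP[x21 x22] /andP[x31 x32].
apply: avgs2_ge => //; try lra.
move=> z0 z1 /andP[z01 z02] /andP[z11 z12].
set w1 := upd _ _ _.
have e0 : w1 (4 * p + 0)%N = z0 by rewrite /w1 /upd eqxx.
have e1 : w1 (4 * p + 1)%N = z1 by rewrite /w1 /upd !eqn_add2l.
have e2 : w1 (4 * p + 2)%N = x2 by rewrite /w1 /upd -!addnA !eqn_add2l.
have e3 : w1 (4 * p + 3)%N = x3 by rewrite /w1 /upd -!addnA !eqn_add2l.
clearbody w1.
have z01' : 1 <= z0 <= 2 by apply/andP.
have z11' : 1 <= z1 <= 2 by apply/andP.
have x21' : 1 <= x2 <= 2 by apply/andP.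
have x31' : 1 <= x3 <= 2 by apply/andP.
apply: (block_ge mh h0 x01 ler01 z01' z11' x21' x31').
rewrite -e0 -e1 -e2 -e3 => w2 aw2 al; apply: avgs_ge => // w3 aw3.
have qp : q != p by rewrite eq_sym.
have -> : ind (aligned x q p) w3 = ind (aligned x q p) w2.
  by rewrite /ind /aligned (pair_det_agree hq hp aw3) (nrm_sqr_agree hp aw3) (nrm_sqr_agree hq aw3).
rewrite lee_fin ler1n lt0b /aligned /pair_det (nrm_sqr_agree qp aw2).
by rewrite !(agree_off_block qp _ aw2).
Qed.

End roles.
End events.

(** * Independent users and the event that only good users are scheduled *)

Section users.
Context {R : realType}.
Local Notation mu := (normal_prob (0 : R) cn_std).
Implicit Types (b : sample R -> bool) (w : sample R).

(* A user with aligned interferers for which the rate bound [rate_ge] may fail. *)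
Definition bad_user (M x delta : R) (h p q : nat) w : bool :=
  [|| large_vec M h w, large_vec M p w, large_vec M q w, null_vec p w, null_vec q w |
      close_to (x * M) q p w && close_to delta h p w].

Lemma measurable_bad_user M x delta h p q :
  measurable_fun setT (bad_user M x delta h p q).
Proof.
do 3 (apply: measurable_orb; first exact: measurable_large_vec).
do 2 (apply: measurable_orb; first exact: measurable_null_vec).
by apply: measurable_and; exact: measurable_close_to.
Qed.

Lemma avgs_bad_user_le (M x delta : R) h p q w :
  (h < 3)%N -> (p < 3)%N -> (q < 3)%N -> h != p -> h != q -> p != q ->
  0 <= M -> 0 <= x -> 0 <= delta ->
  (avgs mu 0 12 (ind (bad_user M x delta h p q)) w <=
     (24 * expR (- M / 8) + 64 * (x * M) * delta)%:E)%E.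
Proof.
move=> h3 p3 q3 hp hq pq M0 x0 d0.
have mc : measurable_fun setT (fun w => close_to (x * M) q p w && close_to delta h p w).
  by apply: measurable_and; exact: measurable_close_to.
have ml := @measurable_large_vec R M; have mn := @measurable_null_vec R.
set c := 8 * expR (- M / 8).
rewrite (_ : 24 * _ + _ = c + (c + (c + (0 + (0 + 64 * (x * M) * delta))))); last by rewrite /c; ring.
apply: avgs_or_le; [exact: ml| |exact: avgs_large_le|].
  do 2 (apply: measurable_orb; first exact: ml).
  by do 2 (apply: measurable_orb; first exact: mn).
apply: avgs_or_le; [exact: ml| |exact: avgs_large_le|].
  apply: measurable_orb; first exact: ml.
  by do 2 (apply: measurable_orb; first exact: mn).
apply: avgs_or_le; [exact: ml| |exact: avgs_large_le|].
  by do 2 (apply: measurable_orb; first exact: mn).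
apply: avgs_or_le; [exact: mn| |exact: avgs_null_le|].
  by apply: measurable_orb; first exact: mn.
apply: avgs_or_le; [exact: mn|exact: mc|exact: avgs_null_le|].
by apply: avgs_close_le => //; rewrite mulr_ge0.
Qed.

(** The indicator of an event shared by all users, kept as a product so that the factor of the last
    user can be separated; user [k] owns the [N] coordinates from k * N on. *)
Definition all_users (N K : nat) b w : R := \prod_(k < K) (b (shift (k * N) w))%:R.

Lemma all_users_ge0 N K b w : 0 <= all_users N K b w.
Proof. by apply: prodr_ge0 => k _; rewrite ler0n. Qed.

Lemma measurable_user n b : measurable_fun setT b ->
  measurable_fun setT (fun w => (b (shift n w))%:R : R).
Proof.
move=> mb; apply: (measurableT_comp (f := fun c : bool => c%:R : R)) => //.
exact: (measurableT_comp mb (measurable_shift n)).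
Qed.

Lemma all_usersS N K b w :
  all_users N K.+1 b w = all_users N K b w * (b (shift (K * N) w))%:R.
Proof. by rewrite /all_users big_ord_recr. Qed.

Lemma measurable_all_users N K b : measurable_fun setT b ->
  measurable_fun setT (all_users N K b).
Proof.
move=> mb; elim: K => [|K IH].
  by rewrite (_ : all_users _ _ _ = fun=> 1)//; apply/funext => w; rewrite /all_users big_ord0.
rewrite (_ : all_users _ _ _ = fun w => all_users N K b w * (b (shift (K * N) w))%:R).
  by apply: measurable_funM => //; exact: measurable_user.
by apply/funext => w; exact: all_usersS.
Qed.

(** Independence: the factor of the last user does not involve the first K * N coordinates and
    leaves their average by [avgs_pull]. *)
Lemma avgs_all_usersS N K b w : measurable_fun setT b ->
  avgs mu 0 (K.+1 * N) (fun w => (all_users N K.+1 b w)%:E) w =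
  avgs mu (K * N) N (fun w => ind b (shift (K * N) w) *
     avgs mu 0 (K * N) (fun w => (all_users N K b w)%:E) w)%E w.
Proof.
move=> mb; rewrite mulSnr avgs_cat add0n; congr (avgs _ _ _ _ w); apply/funext => w'.
rewrite -(@avgs_pull _ mu 0 (K * N) _ (fun w => (b (shift (K * N) w))%:R)).
- congr (avgs _ _ _ _ w'); apply/funext => w''.
  by rewrite all_usersS mulrC EFinM.
- by apply/measurable_EFinP; exact: measurable_all_users.
- by move=> w''; rewrite lee_fin all_users_ge0.
- by move=> w''; rewrite ler0n.
- move=> w'' i x /andP[_ iKN]; congr ((b _)%:R); apply/funext => m.
  by rewrite /shift /upd gtn_eqF// (leq_trans iKN) ?leq_addr.
Qed.

Lemma avgs_all_users_le N K b (c : R) w : measurable_fun setT b -> 0 <= c ->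
  (forall w, avgs mu 0 N (ind b) w <= c%:E)%E ->
  (avgs mu 0 (K * N) (fun w => (all_users N K b w)%:E) w <= (c ^+ K)%:E)%E.
Proof.
move=> mb c0 bc; elim: K w => [|K IH] w.
  by rewrite mul0n /= /all_users big_ord0.
have mi := measurable_ind mb.
have mis : measurable_fun setT (fun w => ind b (shift (K * N) w)).
  exact: (measurableT_comp mi (measurable_shift _)).
rewrite avgs_all_usersS//.
apply: (@le_trans _ _ (avgs mu (K * N) N (fun w => (c ^+ K)%:E * ind b (shift (K * N) w)) w)%E).
  apply: le_avgs => w'.
    by rewrite mule_ge0 ?ind_ge0//; apply: avgs_ge0 => w''; rewrite lee_fin all_users_ge0.
  by rewrite muleC lee_wpmul2r ?ind_ge0.
rewrite avgsZl ?exprn_ge0//; last by move=> w'; exact: ind_ge0.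
have := avgs_shift mu (K * N) 0 N (ind b) w; rewrite addn0 => ->.
by rewrite exprSr EFinM lee_wpmul2l// lee_fin exprn_ge0.
Qed.

Lemma avgs_all_users_ge N K b (c : R) w : measurable_fun setT b -> 0 <= c ->
  (forall w, c%:E <= avgs mu 0 N (ind b) w)%E ->
  ((c ^+ K)%:E <= avgs mu 0 (K * N) (fun w => (all_users N K b w)%:E) w)%E.
Proof.
move=> mb c0 bc; elim: K w => [|K IH] w.
  by rewrite mul0n /= /all_users big_ord0.
have mi := measurable_ind mb.
have mis : measurable_fun setT (fun w => ind b (shift (K * N) w)).
  exact: (measurableT_comp mi (measurable_shift _)).
rewrite avgs_all_usersS//.
apply: (@le_trans _ _ (avgs mu (K * N) N (fun w => (c ^+ K)%:E * ind b (shift (K * N) w)) w)%E); last first.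
  apply: le_avgs => w'; first by rewrite mule_ge0 ?ind_ge0// lee_fin exprn_ge0.
  by rewrite muleC lee_wpmul2l ?ind_ge0.
rewrite avgsZl ?exprn_ge0//; last by move=> w'; exact: ind_ge0.
have := avgs_shift mu (K * N) 0 N (ind b) w; rewrite addn0 => ->.
by rewrite exprSr EFinM lee_wpmul2l// lee_fin exprn_ge0.
Qed.

Definition some_selected (N K : nat) (b s : sample R -> bool) w : bool :=
  [exists k : 'I_K, s (shift (k * N) w)] && [forall k : 'I_K, ~~ b (shift (k * N) w)].

Lemma all_usersE N K b w : all_users N K b w = [forall k : 'I_K, b (shift (k * N) w)]%:R.
Proof.
rewrite /all_users; case: forallP => [h|/forallP].
  by rewrite big1// => k _; rewrite h.
rewrite negb_forall => /existsP[k nb].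
by rewrite (bigD1 k)//= (negbTE nb) mul0r.
Qed.

(** Splits the event that nobody satisfies [b] by whether somebody satisfies [s]; the other part is
    again a condition imposed on each user separately. *)
Lemma all_users_not N K b s w : all_users N K (fun w => ~~ b w) w =
  (some_selected N K b s w)%:R + all_users N K (fun w => ~~ b w && ~~ s w) w.
Proof.
rewrite !all_usersE -natrD /some_selected; congr (_%:R).
case: (boolP [forall k, _]) => [/forallP nb|].
  rewrite andbT; case: existsP => [[k sk]|/forallNP h].
    rewrite (_ : [forall k0, _] = false)//; apply/negbTE.
    by rewrite negb_forall; apply/existsP; exists k; rewrite sk andbF.
  rewrite (_ : [forall k, _] = true)//; apply/forallP => k.
  by rewrite nb /=; apply/negP; exact: h.
rewrite negb_forall andbF => /existsP[k bk].
rewrite (_ : [forall k0, _] = false)//; apply/negbTE.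
by rewrite negb_forall; apply/existsP; exists k; rewrite (negbTE bk).
Qed.

Lemma measurable_ind_some_selected N K b s :
  measurable_fun setT b -> measurable_fun setT s ->
  measurable_fun setT (ind (some_selected N K b s)).
Proof.
move=> mb ms; have mnb := measurable_not mb; have mns := measurable_not ms.
apply/measurable_EFinP; rewrite (_ : (fun w => _) = fun w =>
  all_users N K (fun w => ~~ b w) w - all_users N K (fun w => ~~ b w && ~~ s w) w).
  by apply: measurable_funB; apply: measurable_all_users => //; exact: measurable_and.
by apply/funext => w; rewrite (all_users_not N K b s) addrK.
Qed.

(* The indicator of [some_selected] is a difference of two products over users. *)
Lemma avgs_some_selected_ge N K b s (z c : R) w :
  measurable_fun setT b -> measurable_fun setT s -> z <= 1 -> c <= 1 ->
  (forall w, avgs mu 0 N (ind b) w <= z%:E)%E ->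
  (forall w, c%:E <= avgs mu 0 N (ind s) w)%E ->
  (((1 - z) ^+ K - (1 - c) ^+ K)%:E <= avgs mu 0 (K * N) (ind (some_selected N K b s)) w)%E.
Proof.
move=> mb ms z1 c1 bz sc.
have mnb := measurable_not mb; have mns := measurable_not ms.
pose n w := ~~ b w && ~~ s w.
have mn : measurable_fun setT n by exact: measurable_and.
have mF := measurable_ind_some_selected N K mb ms.
have split : (avgs mu 0 (K * N) (fun w => (all_users N K (fun w => ~~ b w) w)%:E) w =
  avgs mu 0 (K * N) (ind (some_selected N K b s)) w +
  avgs mu 0 (K * N) (fun w => (all_users N K n w)%:E) w)%E.
  rewrite -avgsD//; [|exact: ind_ge0| |]; last 2 first.
  - by apply/measurable_EFinP; exact: measurable_all_users.
  - by move=> w'; rewrite lee_fin all_users_ge0.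
  by congr (avgs _ _ _ _ w); apply/funext => w'; rewrite /ind -EFinD (all_users_not N K b s).
have compl b' w' : measurable_fun setT b' ->
   (avgs mu 0 N (ind (fun w => ~~ b' w)) w' = 1 - avgs mu 0 N (ind b') w')%E.
  move=> mb'; have := avgs_not 0 N w' mb'; rewrite addeC => <-; rewrite addeK// ge0_fin_numE.
    apply: (le_lt_trans (avgs_le (c := 1) _ _)) (ltry _) => [w''|w'' _]; first exact: ind_ge0.
    by rewrite lee_fin lern1 leq_b1.
  by apply: avgs_ge0 => w''; exact: ind_ge0.
have hA : ((((1 - z) ^+ K)%:E) <= avgs mu 0 (K * N) (fun w => (all_users N K (fun w => ~~ b w) w)%:E) w)%E.
  apply: avgs_all_users_ge => //; first by rewrite subr_ge0.
  by move=> w'; rewrite compl// EFinB leeB.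
have hN : (avgs mu 0 (K * N) (fun w => (all_users N K n w)%:E) w <= ((1 - c) ^+ K)%:E)%E.
  apply: avgs_all_users_le => //; first by rewrite subr_ge0.
  move=> w'; apply: (@le_trans _ _ (avgs mu 0 N (ind (fun w => ~~ s w)) w')).
    apply: le_avgs => [w''|w'']; first exact: ind_ge0.
    by apply: le_ind => /andP[].
  by rewrite compl// EFinB leeB.
rewrite EFinB leeBlDr//; apply: (le_trans hA); rewrite split; exact: leeD2l.
Qed.

End users.

(** * Metric and postfilter in dimension two *)

Section two_dimensional.
Local Open Scope complex_scope.
Context {R : realType}.
Local Notation C := R[i].
Local Notation i1 := (lift ord0 ord0).
Implicit Types (z : C) (u v p q h : 'M[C]_(2, 1)).

Definition sqn z : R := complex.Re z ^+ 2 + complex.Im z ^+ 2.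
Definition vnorm u : R := sqn (u ord0 ord0) + sqn (u i1 ord0).
Definition vdet u v : C := u ord0 ord0 * v i1 ord0 - u i1 ord0 * v ord0 ord0.
Definition vdot u v : C := Num.conj (u ord0 ord0) * v ord0 ord0 + Num.conj (u i1 ord0) * v i1 ord0.

Lemma conjE z : Num.conj z = conjc z. Proof. by []. Qed.

Lemma sqnE z : (sqn z)%:C = Num.conj z * z.
Proof. by case: z => a b; rewrite conjE; apply/eqP; rewrite eq_complex /sqn /=; apply/andP; split; apply/eqP; ring. Qed.

Lemma sqnM z z' : sqn (z * z') = sqn z * sqn z'.
Proof. by case: z => a b; case: z' => c d; rewrite /sqn /=; ring. Qed.

Lemma sqn_conj z : sqn (Num.conj z) = sqn z.
Proof. by case: z => a b; rewrite /sqn /= sqrrN. Qed.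

Lemma sqn_ge0 z : 0 <= sqn z.
Proof. by rewrite addr_ge0 ?sqr_ge0. Qed.

Lemma vnorm_ge0 u : 0 <= vnorm u.
Proof. by rewrite addr_ge0 ?sqn_ge0. Qed.

Lemma sqn_real (a : R) : sqn a%:C = a ^+ 2.
Proof. by rewrite /sqn /= expr0n addr0. Qed.

Lemma vnormE u : (vnorm u)%:C = vdot u u.
Proof. by rewrite /vnorm rmorphD /= !sqnE. Qed.

Lemma lagrange u v : sqn (vdot u v) + sqn (vdet u v) = vnorm u * vnorm v.
Proof.
apply: (@complexI R); rewrite rmorphD rmorphM /= !sqnE !vnormE /vdot /vdet.
by rewrite !rmorphB !rmorphD !rmorphM /= !conjCK; ring.
Qed.

(** The difference of the two sides is |2 z + z'|^2 / 2. *)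
Lemma sqnD_ge z z' : sqn z' / 2 - sqn z <= sqn (z + z').
Proof. by case: z => a b; case: z' => c d; rewrite /sqn /=; have := sqr_ge0 (2 * a + c); have := sqr_ge0 (2 * b + d); lra. Qed.

Lemma adjmx_mulE u v : adjmx u *m v = (vdot u v)%:M.
Proof. by rewrite [LHS]mx11_scalar /vdot !mxE !big_ord_recl big_ord0 !mxE addr0. Qed.

Lemma vdotC u v : vdot v u = Num.conj (vdot u v).
Proof. by rewrite /vdot rmorphD !rmorphM /= !conjCK ![_ * Num.conj _]mulrC. Qed.

(** Expands h along p and the orthogonal vector with entries - conj p_1 and conj p_0, then pairs
    with u; the factor |p|^2 avoids normalising p. *)
Lemma det_polar p u h : vdot u h * (vnorm p)%:C = vdot u p * vdot p h + Num.conj (vdet p u) * vdet p h.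
Proof. by rewrite vnormE /vdot /vdet rmorphB !rmorphM /=; ring. Qed.

(* For unit vectors, half of this is the squared chordal distance. *)
Lemma frob2_proj u v :
  frob2 (u *m adjmx u - v *m adjmx v) = (vnorm u - vnorm v) ^+ 2 + 2 * sqn (vdet u v).
Proof.
rewrite /frob2 !big_ord_recl !big_ord0 !mxE !big_ord_recl !big_ord0 !mxE /vnorm /vdet.
case: (u ord0 ord0) => a b; case: (u i1 ord0) => c d.
case: (v ord0 ord0) => e f; case: (v i1 ord0) => g l.
by rewrite /sqn /=; ring.
Qed.

(** A column with the same span as v is a multiple of it. Normalising v shows that such a unit
    column exists, so [xget] does not fall back on its default 0. *)
Lemma onbP v : 0 < vnorm v ->
  exists c : C, [/\ sqn c * vnorm v = 1 & forall i, onb v i ord0 = c * v i ord0].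
Proof.
move=> v0.
have ex : exists Q, is_onb_colspace v Q.
  exists ((Num.sqrt (vnorm v))^-1%:C *: v); split.
    rewrite adjmx_mulE /vdot !mxE !rmorphM /= !conjE !conjc_real.
    rewrite (_ : _ + _ = ((Num.sqrt (vnorm v))^-1 ^+ 2)%:C * (vnorm v)%:C); last first.
      by rewrite rmorphXn /= vnormE /vdot; ring.
    by rewrite -rmorphM /= exprVn sqr_sqrtr ?ltW// mulVf ?gt_eqF.
  rewrite linearZ /=; apply/eqmxP; apply: eqmx_scale.
  by rewrite eq_complex /= eqxx andbT invr_eq0 gt_eqF// sqrtr_gt0.
have /= [QQ /andP[/submxP[D QD] _]] : is_onb_colspace v (onb v).
  by case: ex => Q hQ; rewrite /onb; exact: (@xgetI _ 0 [set Q | is_onb_colspace v Q] Q hQ).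
exists (D ord0 ord0); have Qi i : onb v i ord0 = D ord0 ord0 * v i ord0.
  by move/matrixP: QD => /(_ ord0 i); rewrite !mxE big_ord_recl big_ord0 addr0 mxE.
split => //; apply: (@complexI R); rewrite rmorphM /= sqnE vnormE.
have : vdot (onb v) (onb v) = 1.
  have := QQ; rewrite adjmx_mulE => /matrixP/(_ ord0 ord0); rewrite !mxE /=.
  by rewrite !mulr1n.
move=> nQ; transitivity (vdot (onb v) (onb v)); last exact: nQ.
by rewrite /vdot !Qi !rmorphM /=; ring.
Qed.

(** Only the moduli of the scalars from [onbP] enter, and normalisation fixes them; the choice of
    bases drops out. *)
Lemma metricE p q : 0 < vnorm p -> 0 < vnorm q ->
  metric p q * (vnorm p * vnorm q) = sqn (vdet p q).
Proof.
move=> p0 q0; have [c [cp cE]] := onbP p0; have [d [dq dE]] := onbP q0.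
rewrite /metric /chordal_dist exprMn exprVn !sqr_sqrtr ?ler0n//; last first.
  by rewrite frob2_proj addr_ge0 ?sqr_ge0// mulr_ge0 ?sqn_ge0.
rewrite frob2_proj.
have -> : vnorm (onb p) = 1 by rewrite /vnorm !cE !sqnM -mulrDr.
have -> : vnorm (onb q) = 1 by rewrite /vnorm !dE !sqnM -mulrDr.
have -> : vdet (onb p) (onb q) = c * d * vdet p q by rewrite /vdet !cE !dE; ring.
rewrite subrr expr0n add0r mulKf ?pnatr_eq0// !sqnM.
rewrite -[RHS]mul1r -[1](mulr1 1) -{1}cp -dq; ring.
Qed.

End two_dimensional.

(** * Rate, postfilter and residual interference *)

Section postfilter_bounds.
Local Open Scope complex_scope.
Context {R : realType}.
Local Notation C := R[i].
Local Notation i1 := (lift ord0 ord0).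
Implicit Types (z : C) (u v p q h : 'M[C]_(2, 1)).

Lemma rateE (P : R) h p q : 0 <= P ->
  rate P h p q = let u := postfilter p q in
    log2 (1 + P * sqn (vdot u h) / (1 + P * (sqn (vdot u p) + sqn (vdot u q)))).
Proof.
move=> P0; rewrite /rate; set u := postfilter p q; cbv zeta.
have E v : adjmx u *m v *m adjmx v *m u = (sqn (vdot u v))%:C%:M.
  by rewrite -mulmxA !adjmx_mulE -scalar_mxM sqnE (vdotC u v) mulrC.
have b0 : 0 < 1 + P * (sqn (vdot u p) + sqn (vdot u q)).
  by rewrite ltr_wpDr// mulr_ge0// addr_ge0 ?sqn_ge0.
rewrite !E -!raddfD /= !scale_scalar_mx -raddfD /= invmx_scalar -scalar_mxM -raddfD /= det_scalar1.
set t := P * sqn (vdot u h); set b := 1 + P * _ in b0 *.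
have -> : P%:C * (sqn (vdot u h))%:C = t%:C by rewrite -rmorphM.
have -> : 1 + P%:C * (sqn (vdot u p) + sqn (vdot u q))%:C = b%:C.
  by rewrite /b [RHS]rmorphD rmorphM.
have -> // : 1 + t%:C / b%:C = (1 + t / b)%:C.
by clearbody t b; rewrite [RHS]rmorphD rmorphM fmorphV.
Qed.

Lemma rate_ge0 (P : R) h p q : 0 <= P -> 0 <= rate P h p q.
Proof.
move=> P0; rewrite rateE//= /log2 divr_ge0 ?ln_ge0 ?ler1n// lerDl.
by rewrite divr_ge0 ?mulr_ge0 ?sqn_ge0// addr_ge0// mulr_ge0// addr_ge0 ?sqn_ge0.
Qed.

Lemma adjmxK m n (A : 'M[C]_(m, n)) : adjmx (adjmx A) = A.
Proof. by apply/matrixP => i j; rewrite !mxE conjCK. Qed.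

Lemma adjmxM m n k (A : 'M[C]_(m, n)) (B : 'M[C]_(n, k)) :
  adjmx (A *m B) = adjmx B *m adjmx A.
Proof. by rewrite /adjmx map_mxM trmx_mul. Qed.

Lemma adjmxD m n (A B : 'M[C]_(m, n)) : adjmx (A + B) = adjmx A + adjmx B.
Proof. by rewrite /adjmx map_mxD linearD. Qed.

Lemma Rmx_adj p q : adjmx (Rmx p q) = Rmx p q.
Proof. by rewrite /Rmx adjmxD !adjmxM !adjmxK. Qed.

(** [Rmx] is Hermitian and positive semidefinite, so its spectral decomposition is a singular value
    decomposition with W = V; hence a postfilter exists and [xget] returns one. *)
Lemma postfilterP p q : is_postfilter (Rmx p q) (postfilter p q).
Proof.
suff [u hu] : exists u, is_postfilter (Rmx p q) u.
  exact: (@xgetI _ 0 [set u | is_postfilter (Rmx p q) u] u hu).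
pose M := Rmx p q.
have tE m n (A : 'M[C]_(m, n)) : map_mx Num.conj A^T = adjmx A by rewrite /adjmx map_trmx.
have Mn : M \is normalmx by apply/normalmxP; rewrite tE Rmx_adj.
have /orthomx_spectralP := Mn; set S := spectralmx M; set d := spectral_diag M.
have Su : S \is unitarymx by exact: spectral_unitarymx.
rewrite invmx_unitary// tE => ME.
have SS : S *m adjmx S = 1%:M by rewrite -tE; apply/unitarymxP.
have SS' : adjmx S *m S = 1%:M by exact: mulmx1C SS.
have dE : diag_mx d = (S *m p) *m adjmx (S *m p) + (S *m q) *m adjmx (S *m q).
  have -> : diag_mx d = S *m M *m adjmx S.
    by rewrite ME !mulmxA SS mul1mx -mulmxA SS mulmx1.
  by rewrite /M /Rmx mulmxDr mulmxDl !adjmxM !mulmxA.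
(* The eigenvalues are read off the diagonal of S [Rmx] S^H, where they are visibly sums of squared
   moduli. *)
pose s : 'rV[R]_2 := \row_i (sqn ((S *m p) i ord0) + sqn ((S *m q) i ord0)).
have sE : d = map_mx (fun x : R => x%:C) s.
  apply/rowP => i; have /matrixP/(_ i i) := dE; rewrite /s; move: (S *m p) (S *m q) => x y.
  rewrite !mxE eqxx mulr1n !big_ord_recl !big_ord0 !mxE !addr0 => ->.
  by rewrite rmorphD /= !sqnE ![Num.conj _ * _]mulrC.
have s0 i : 0 <= s ord0 i by rewrite mxE addr_ge0 ?sqn_ge0.
have [sle|slt] := leP (s ord0 i1) (s ord0 ord0).
  exists (col i1 (adjmx S)), (adjmx S), (adjmx S), s; split => //.
  - by rewrite adjmxK.
  - by rewrite adjmxK.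
  - by rewrite s0.
  - by rewrite adjmxK -sE.
(* The decomposition comes in no particular order: when the eigenvalues increase, the two columns
   are exchanged. *)
pose t : 'S_2 := tperm ord0 i1; pose T : 'M[C]_2 := perm_mx t.
have TT : T *m T = 1%:M by rewrite -perm_mxM /t tperm2 perm_mx1.
have adjT : adjmx T = T by rewrite /adjmx map_perm_mx tr_perm_mx /t tpermV.
pose s' := col_perm t s.
have dT : T *m diag_mx (map_mx (fun x : R => x%:C) s') *m T = diag_mx d.
  rewrite /T -row_permE -{2}[t]invgK -col_permE sE; apply/matrixP => i j.
  by rewrite /t !mxE tpermV (inj_eq perm_inj) tpermK.
have WW : adjmx (adjmx S *m T) *m (adjmx S *m T) = 1%:M.
  by rewrite adjmxM adjmxK adjT mulmxA -(mulmxA T) SS mulmx1 TT.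
exists (col i1 (adjmx S *m T)), (adjmx S *m T), (adjmx S *m T), s'; split => //.
- have -> : s' ord0 i1 = s ord0 ord0 by rewrite [LHS]mxE tpermR.
  have -> : s' ord0 ord0 = s ord0 i1 by rewrite [LHS]mxE tpermL.
  by rewrite s0 ltW.
- by rewrite adjmxM adjmxK adjT !mulmxA -(mulmxA (adjmx S)) -(mulmxA (adjmx S)) dT.
Qed.

Lemma cauchy_schwarz u v : sqn (vdot u v) <= vnorm u * vnorm v.
Proof. by rewrite -lagrange lerDl sqn_ge0. Qed.

Lemma col_unitary (W : 'M[C]_2) i : adjmx W *m W = 1%:M -> vnorm (col i W) = 1.
Proof.
move=> /matrixP/(_ i i) WW; apply: (@complexI R); rewrite vnormE /vdot.
by move: WW; rewrite !mxE eqxx !big_ord_recl big_ord0 !mxE addr0.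
Qed.

Lemma frob2_trace n (A : 'M[C]_n) : (frob2 A)%:C = \tr (A *m adjmx A).
Proof.
rewrite /frob2 /mxtrace rmorph_sum; apply: eq_bigr => i _.
rewrite rmorph_sum mxE; apply: eq_bigr => j _.
by rewrite !mxE mulrC -sqnE.
Qed.

(** This is the trace squared minus twice the determinant, the sum of the squared eigenvalues. *)
Lemma frob2_Rmx p q : frob2 (Rmx p q) = (vnorm p + vnorm q) ^+ 2 - 2 * sqn (vdet p q).
Proof.
rewrite /frob2 /Rmx !big_ord_recl !big_ord0 !mxE !big_ord_recl !big_ord0 !mxE /vnorm /vdet.
case: (p ord0 ord0) => a b; case: (p i1 ord0) => c d.
case: (q ord0 ord0) => e f; case: (q i1 ord0) => g l.
by rewrite /sqn /=; ring.
Qed.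

Lemma det_mx22 (A : 'M[C]_2) :
  \det A = A ord0 ord0 * A i1 i1 - A ord0 i1 * A i1 ord0.
Proof.
rewrite (expand_det_row A ord0) !big_ord_recl big_ord0 /cofactor !det_mx11 !mxE /=.
rewrite addr0 expr0 mul1r expr1 mulN1r mulrN; congr (_ * A _ _ - A _ _ * A _ _); exact: val_inj.
Qed.

(** [Rmx] is the square matrix with columns p, q times its adjoint. *)
Lemma det_Rmx p q : \det (Rmx p q) = (sqn (vdet p q))%:C.
Proof.
rewrite sqnE det_mx22 /Rmx !mxE !big_ord_recl !big_ord0 !mxE /vdet rmorphB !rmorphM /=.
ring.
Qed.

Lemma sqn_det_unitary (W : 'M[C]_2) : adjmx W *m W = 1%:M -> sqn (\det W) = 1.
Proof.
move=> WW; apply: (@complexI R); rewrite sqnE.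
have := f_equal (fun A => \det A) WW; rewrite det_mulmx det1 /adjmx det_tr det_map_mx.
exact.
Qed.

(* The singular values a >= b satisfy ab = |det(p, q)|^2 and a + b = |p|^2 + |q|^2, so that
   b (|p|^2 + |q|^2) <= 2ab, and the residual interference is at most b. *)
Lemma postfilter_facts p q (u := postfilter p q) (lam := sqn (vdot u p) + sqn (vdot u q)) :
  vnorm u = 1 /\ lam * (vnorm p + vnorm q) <= 2 * sqn (vdet p q).
Proof.
have [W [V [s [WW VV /andP[s10 s01] ME uE]]]] := postfilterP p q.
rewrite -/u in uE.
set a := s ord0 ord0 in s01; set b := s ord0 i1 in s10 s01.
set S := diag_mx _ in ME.
have adjS : adjmx S = S.
  apply/matrixP => i j; rewrite !mxE eq_sym; case: eqP => [->|_].
    by rewrite !mulr1n conjE conjc_real.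
  by rewrite !mulr0n conjE conjc0.
have u1 : vnorm u = 1 by rewrite uE col_unitary.
split => //.
pose e : 'cV[C]_2 := delta_mx i1 ord0.
(* W and V may differ, so self-adjointness is used: [Rmx] u = V S W^H u is b times the second column
   of V, and lam = u^H [Rmx] u. *)
have lamE : lam%:C = b%:C * vdot u (col i1 V).
  have Se : S *m e = b%:C *: e.
    apply/matrixP => i j; rewrite /S mul_diag_mx !mxE.
    by case: eqP => [->//|_]; rewrite /= !mulr0.
  have MuE : Rmx p q *m u = b%:C *: col i1 V.
    rewrite -Rmx_adj ME !adjmxM adjmxK adjS uE !colE -/e.
    by rewrite -!mulmxA (mulmxA (adjmx W)) WW mul1mx Se -scalemxAr.
  have : adjmx u *m Rmx p q *m u = (lam%:C)%:M.
    rewrite /Rmx mulmxDr mulmxDl !mulmxA -(mulmxA _ (adjmx p)) -(mulmxA _ (adjmx q)).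
    rewrite !adjmx_mulE -!scalar_mxM -raddfD /= (vdotC u p) (vdotC u q); congr (_%:M).
    by rewrite /lam [RHS]rmorphD /= !sqnE ![Num.conj _ * _]mulrC.
  rewrite -mulmxA MuE -scalemxAr adjmx_mulE scale_scalar_mx => /matrixP/(_ ord0 ord0).
  by rewrite !mxE eqxx !mulr1n.
have lam0 : 0 <= lam by rewrite addr_ge0 ?sqn_ge0.
have lamb : lam <= b.
  rewrite -ler_sqr ?nnegrE// -(sqn_real lam) lamE sqnM sqn_real ler_piMr ?sqr_ge0//.
  by apply: le_trans (cauchy_schwarz _ _) _; rewrite u1 (col_unitary _ VV) mulr1.
(* det W and det V have modulus one but unknown phase, so squared moduli are compared. *)
have detE : (a * b) ^+ 2 = sqn (vdet p q) ^+ 2.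
  rewrite -[RHS]sqn_real -det_Rmx ME !det_mulmx !sqnM det_diag !big_ord_recl big_ord0 !mxE.
  rewrite (sqn_det_unitary WW) /adjmx det_tr det_map_mx sqn_conj (sqn_det_unitary VV).
  by rewrite mulr1 mul1r mulr1 sqnM !sqn_real exprMn.
have abE : a * b = sqn (vdet p q).
  by apply/eqP; rewrite -(@eqrXn2 _ 2)// ?sqn_ge0 ?mulr_ge0 ?detE//; exact: le_trans s01.
have trE : a ^+ 2 + b ^+ 2 = (vnorm p + vnorm q) ^+ 2 - 2 * sqn (vdet p q).
  rewrite -frob2_Rmx; apply: (@complexI R); rewrite frob2_trace ME !adjmxM adjmxK adjS.
  rewrite !mulmxA -(mulmxA _ (adjmx V)) VV mulmx1 mxtrace_mulC !mulmxA WW mul1mx.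
  rewrite mulmx_diag mxtrace_diag !big_ord_recl big_ord0 !mxE addr0.
  by rewrite rmorphD !rmorphXn /= !expr2.
have vp := vnorm_ge0 p; have vq := vnorm_ge0 q.
have a0 : 0 <= a by exact: le_trans s01.
have ab : a + b = vnorm p + vnorm q.
  have e2 : (a + b) ^+ 2 = (vnorm p + vnorm q) ^+ 2 by rewrite sqrrD addrAC trE abE; ring.
  have := @eqrXn2 R 2 (a + b) (vnorm p + vnorm q) isT (addr_ge0 a0 s10) (addr_ge0 vp vq).
  by rewrite e2 eqxx => /esym/eqP.
rewrite -ab -abE; nra.
Qed.

(** The postfilter is nearly orthogonal to p, while h keeps a component off the line of p; hence the
    signal |u^H h|^2 is at least delta / 4 against interference at most 2 x M. *)
Lemma rate_ge (P M x delta : R) h p q : 0 <= P -> 0 < x <= 16^-1 -> x * M <= delta / 16 ->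
  0 < vnorm p -> 0 < vnorm q -> vnorm p <= M -> vnorm q <= M -> vnorm h <= M -> 0 <= delta ->
  sqn (vdet p q) <= x * vnorm p * vnorm q ->
  delta * vnorm p <= sqn (vdet p h) ->
  log2 (1 + P * (delta / 4) / (1 + P * (2 * (x * M)))) <= rate P h p q.
Proof.
move=> P0 /andP[x0 x1] xM p0 q0 pM qM hM d0 Qx hd.
rewrite rateE//; have [/= u1 lam2] := postfilter_facts p q.
set u := postfilter p q in u1 lam2 *; set lam := _ + _ in lam2 *.
have lam0 : 0 <= lam by rewrite addr_ge0 ?sqn_ge0.
have lamx : lam <= 2 * x * vnorm p.
  have T0 : 0 < vnorm p + vnorm q by rewrite addr_gt0.
  rewrite -(ler_pM2r T0); apply: (le_trans lam2); apply: (@le_trans _ _ (2 * (x * vnorm p * vnorm q))).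
    by rewrite ler_wpM2l.
  have := mulr_ge0 (ltW x0) (sqr_ge0 (vnorm p)); nra.
have up : sqn (vdot u p) <= 2 * x * vnorm p.
  by apply: le_trans lamx; rewrite lerDl sqn_ge0.
have lamM : lam <= 2 * (x * M).
  by apply: (le_trans lamx); rewrite -mulrA ler_wpM2l// ler_wpM2l// ltW.
(* By [det_polar] and [sqnD_ge] the signal is at least (1 - 2 x) delta / 2 - 2 x M, and the two
   hypotheses with 16 make this at least 7 delta / 16 - 2 delta / 16. *)
have uh : delta / 4 <= sqn (vdot u h).
  have pol := det_polar p u h.
  have := sqnD_ge (vdot u p * vdot p h) (Num.conj (vdet p u) * vdet p h).
  rewrite -pol !sqnM sqn_real sqn_conj => low.
  have lag := lagrange p u; rewrite u1 mulr1 vdotC sqn_conj in lag.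
  have ph : sqn (vdot p h) <= vnorm p * M.
    by apply: (le_trans (cauchy_schwarz _ _)); rewrite ler_wpM2l// ltW.
  have ph0 := sqn_ge0 (vdot p h); have up0 := sqn_ge0 (vdot u p).
  set a := sqn (vdot u p) in up lag low up0; set b := sqn (vdot p h) in low ph ph0.
  set N := vnorm p in p0 pM up lag low ph hd *; set D := sqn (vdet p h) in hd low.
  have ab : a * b <= 2 * (x * M) * N ^+ 2.
    apply: (@le_trans _ _ ((2 * x * N) * (N * M))); first exact: ler_pM.
    by rewrite le_eqVlt; apply/orP; left; apply/eqP; ring.
  have dp : (1 - 2 * x) * N <= sqn (vdet p u) by rewrite -/N in lag; lra.
  have dD : (1 - 2 * x) * delta * N ^+ 2 <= sqn (vdet p u) * D.
    rewrite (_ : _ * N ^+ 2 = (1 - 2 * x) * N * (delta * N)); last by ring.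
    by apply: ler_pM => //; rewrite !mulr_ge0// ?ltW//; lra.
  have N2 : 0 < N ^+ 2 by rewrite exprn_gt0.
  rewrite -(ler_pM2r N2); apply: le_trans low.
  have : delta * N ^+ 2 * x <= delta * N ^+ 2 * 16^-1.
    by rewrite ler_wpM2l// mulr_ge0// ltW.
  have : x * M * N ^+ 2 <= delta / 16 * N ^+ 2 by rewrite ler_wpM2r// ltW.
  nra.
have M0 : 0 <= x * M by rewrite mulr_ge0 ?ltW//; exact: lt_le_trans pM.
have b0 : 0 < 1 + P * lam by rewrite ltr_wpDr// mulr_ge0.
have b1 : 0 < 1 + P * (2 * (x * M)) by rewrite ltr_wpDr// mulr_ge0// mulr_ge0.
rewrite /log2 ler_wpM2r ?invr_ge0 ?ln_ge0 ?ler1n//.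
have pos t b : 0 <= t -> 0 < b -> 0 < 1 + P * t / b.
  by move=> t0 /ltW ?; rewrite ltr_wpDr// divr_ge0// mulr_ge0.
rewrite ler_ln ?posrE ?pos ?sqn_ge0 ?divr_ge0//.
rewrite lerD2l; apply: ler_pM => //.
- by rewrite mulr_ge0// divr_ge0.
- by rewrite invr_ge0 ltW.
- by rewrite ler_wpM2l.
- by rewrite lef_pV2// lerD2l ler_wpM2l.
Qed.

End postfilter_bounds.

(** * Scheduling *)

Section scheduling.
Local Open Scope complex_scope.
Context {R : realType}.
Implicit Types (w : sample R) (i j : 'I_3).

Lemma coord_shift k j r c w : w (Defs.coord k j r c) = shift (k * 12) w (4 * j + (2 * r + c))%N.
Proof. by rewrite /shift /Defs.coord; congr w; lia. Qed.

Lemma vnorm_chan w k j : vnorm (chan w k j) = nrm_sqr j (shift (k * 12) w).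
Proof. by rewrite /vnorm /chan !mxE /sqn /= !coord_shift /nrm_sqr /= addrA. Qed.

Lemma vdet_chan w k j l :
  sqn (vdet (chan w k j) (chan w k l)) = pair_det j l (shift (k * 12) w).
Proof.
by rewrite /vdet /chan !mxE /pair_det /det_sqr /sqn /= !coord_shift /= opprD.
Qed.

Lemma metric_lt (x : R) p q : 0 < vnorm p -> 0 < vnorm q ->
  (metric p q < x) = (sqn (vdet p q) < x * vnorm p * vnorm q).
Proof.
by move=> p0 q0; rewrite -(metricE p0 q0) -mulrA ltr_pM2r// mulr_gt0.
Qed.

Definition selected_rate (P M x delta : R) : R :=
  log2 (1 + P * (delta / 4) / (1 + P * (2 * (x * M)))).

Lemma user_rate_ge (P M x delta : R) i k w :
  0 <= P -> 0 < x <= 16^-1 -> x * M <= delta / 16 -> 0 <= delta ->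
  ~~ bad_user M x delta i (other1 i) (other2 i) (shift (k * 12) w) ->
  metric (chan w k (other1 i)) (chan w k (other2 i)) < x ->
  selected_rate P M x delta <=
    rate P (chan w k i) (chan w k (other1 i)) (chan w k (other2 i)).
Proof.
move=> P0 x01 xM d0; have /andP[x0 _] := x01.
rewrite !negb_or /large_vec /null_vec /close_to -!vnorm_chan -!vdet_chan -!leNgt.
set h := chan w k i; set p := chan w k _; set q := chan w k _.
move=> /and5P[hM pM qM p0 /andP[q0 nc]].
have {}p0 : 0 < vnorm p by rewrite lt_neqAle eq_sym p0 vnorm_ge0.
have {}q0 : 0 < vnorm q by rewrite lt_neqAle eq_sym q0 vnorm_ge0.
have detC u v : sqn (@vdet R u v) = sqn (vdet v u).
  by rewrite /vdet -opprB /sqn !raddfN /= !sqrrN; congr (complex.Re _ ^+ 2 + complex.Im _ ^+ 2); ring.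
rewrite metric_lt// => Qx.
apply: rate_ge => //; first exact: ltW.
(* D < x and |q|^2 <= M make q close to p within x * M; a user that is not bad therefore has h away
   from p. *)
rewrite detC leNgt; apply: contra nc => ->; rewrite andbT detC.
by apply: (lt_le_trans Qx); rewrite mulrAC ler_wpM2r ?ler_wpM2l// ltW.
Qed.

(** On the event the set of reporting users is non-empty and all its members obey [user_rate_ge], so
    their average does too; elsewhere the left side is zero. *)
Lemma sched_rate_ge (P M x delta : R) i K w :
  0 <= P -> 0 < x <= 16^-1 -> x * M <= delta / 16 -> 0 <= delta ->
  selected_rate P M x delta * (some_selected 12 K
     (bad_user M x delta i (other1 i) (other2 i)) (aligned x (other2 i) (other1 i)) w)%:R
   <= sched_rate i K x P w.
Proof.
move=> P0 x01 xM d0; set T := selected_rate _ _ _ _.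
have /andP[x0 _] := x01.
rewrite /sched_rate; set S := [set k : 'I_K | _].
have rk0 (k : 'I_K) : 0 <= rate P (chan w k i) (chan w k (other1 i)) (chan w k (other2 i)).
  exact: rate_ge0.
have [sel|_] := boolP (some_selected _ _ _ _ _); last first.
  by rewrite mulr0; case: ifP => _; rewrite mulr_ge0 ?invr_ge0 ?sumr_ge0.
rewrite mulr1; move: sel => /andP[/existsP[k0 ak0] /forallP nb].
have k0S : k0 \in S.
  apply/mem_set => /=; have := nb k0; rewrite !negb_or => /and5P[_ _ _ p0 /andP[q0 _]].
  have pos j : ~~ null_vec j (shift (k0 * 12) w) -> 0 < vnorm (chan w k0 j).
    by move=> j0; rewrite vnorm_chan lt_neqAle eq_sym j0 nrm_sqr_ge0.
  rewrite /S /= metric_lt ?pos// !vnorm_chan vdet_chan mulrAC.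
  by rewrite /pair_det det_sqrC.
have S0 : (0 < #|S|)%N by apply/card_gt0P; exists k0.
rewrite S0 mulrC ler_pdivlMr ?ltr0n// mulr_natr -sumr_const.
apply: ler_sum => k /set_mem kS; exact: user_rate_ge.
Qed.

Lemma sched_rate_ge0 (P x : R) i K w : 0 <= P -> 0 <= sched_rate i K x P w.
Proof.
move=> P0; rewrite /sched_rate; set S := [set k : 'I_K | _].
have rk0 (k : 'I_K) : 0 <= rate P (chan w k i) (chan w k (other1 i)) (chan w k (other2 i)).
  exact: rate_ge0.
by case: ifP => _; rewrite mulr_ge0 ?invr_ge0 ?sumr_ge0.
Qed.

Lemma sched_rate_local (P x : R) i K w w' :
  (forall m, (m < K * 12)%N -> w m = w' m) -> sched_rate i K x P w = sched_rate i K x P w'.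
Proof.
move=> ww'; pose G (ch : 'I_K -> 'I_3 -> 'M[R[i]]_(2, 1)) :=
  let rk := fun k : 'I_K => rate P (ch k i) (ch k (other1 i)) (ch k (other2 i)) in
  let S := [set k : 'I_K | metric (ch k (other1 i)) (ch k (other2 i)) < x] in
  if (0 < #|S|)%N then (#|S|%:R)^-1 * \sum_(k in S) rk k
  else (K%:R)^-1 * \sum_(k : 'I_K) rk k.
have e : (fun (k : 'I_K) j => chan w k j) = (fun (k : 'I_K) j => chan w' k j).
  apply/funext => k; apply/funext => j; apply/matrixP => r c; rewrite !mxE.
  by congr (_ +i* _); apply: ww'; rewrite /Defs.coord; have := ltn_ord k; have := ltn_ord j; have := ltn_ord r; lia.
exact: (f_equal G e).
Qed.

Lemma expected_rate_ge0 (P x : R) i K : 0 <= P -> (0 <= expected_rate i K x P)%E.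
Proof.
move=> P0; rewrite /expected_rate.
rewrite (gauss_expectE _ (fun=> 0)).
  by apply: avgs_ge0 => w; rewrite lee_fin sched_rate_ge0.
by move=> v v' vv'; rewrite (sched_rate_local P x i vv').
Qed.

Lemma other_neq i : [/\ i != other1 i :> nat, i != other2 i :> nat
  & other1 i != other2 i :> nat].
Proof. by case: i => -[|[|[|]]]. Qed.

(** Averages [sched_rate_ge]; z bounds from above the probability that a user is bad, c from below
    that of alignment. *)
Lemma expected_rate_ge (P M x delta : R) i K :
  let z := 24 * expR (- M / 8) + 64 * (x * M) * delta in
  let c := 4 * density_min ^+ 8 * x in
  0 <= P -> 0 < x <= 16^-1 -> 0 <= M -> x * M <= delta / 16 -> 0 <= delta ->
  z <= 1 -> c <= 1 ->
  ((selected_rate P M x delta * ((1 - z) ^+ K - (1 - c) ^+ K))%:E <= expected_rate i K x P)%E.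
Proof.
move=> z c P0 x01 M0 xM d0 z1 c1; have /andP[x0 x16] := x01.
have x1 : 0 < x <= 1 by rewrite x0 (le_trans x16)// invf_le1 ?ler1n.
rewrite /expected_rate (gauss_expectE _ (fun=> 0)); last first.
  by move=> v v' vv'; rewrite (sched_rate_local P x i vv').
set p := other1 i; set q := other2 i.
have [ip iq pq] := other_neq i.
pose b := bad_user M x delta i p q; pose s := aligned x q p.
have mb : measurable_fun setT b by exact: measurable_bad_user.
have ms : measurable_fun setT s by exact: measurable_aligned.
have T0 : 0 <= selected_rate P M x delta.
  rewrite /selected_rate /log2 divr_ge0 ?ln_ge0 ?ler1n// lerDl.
  have x0' := ltW x0.
  by rewrite divr_ge0// ?addr_ge0// ?mulr_ge0// ?mulr_ge0// ?invr_ge0.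
have main := @avgs_some_selected_ge R 12 K b s z c (fun=> 0) mb ms z1 c1
  (fun w => avgs_bad_user_le w (ltn_ord i) (ltn_ord p) (ltn_ord q) ip iq pq M0 (ltW x0) d0)
  (fun w => avgs_aligned_ge (ltn_ord i) (ltn_ord p) (ltn_ord q) ip iq pq w x1).
set w0 := fun=> 0 in main *; set A := avgs _ 0 _ (ind _) w0 in main.
have {}main : ((selected_rate P M x delta * ((1 - z) ^+ K - (1 - c) ^+ K))%:E <=
    (selected_rate P M x delta)%:E * A)%E by rewrite EFinM lee_wpmul2l.
apply: (le_trans main); rewrite /A.
rewrite -avgsZl//; last 2 first.
- exact: measurable_ind_some_selected.
- exact: ind_ge0.
apply: le_avgs => w; first by rewrite mule_ge0// ?ind_ge0.
by rewrite -EFinM lee_fin; exact: sched_rate_ge.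
Qed.

End scheduling.

(** * Asymptotics *)

Section asymptotics.
Context {R : realType}.

Lemma bernoulli (z : R) n : 0 <= z <= 1 -> 1 - n%:R * z <= (1 - z) ^+ n.
Proof.
move=> /andP[z0 z1]; elim: n => [|n IH]; first by rewrite mul0r subr0 expr0.
rewrite exprS; apply: (@le_trans _ _ ((1 - z) * (1 - n%:R * z))); last first.
  by rewrite ler_wpM2l// subr_ge0.
rewrite -natr1; have := mulr_ge0 (ler0n R n) (sqr_ge0 z); nra.
Qed.

(** Goes through exp(- n c) and exp t >= 1 + t; this crude bound suffices, as n c will grow like ln
    P. *)
Lemma pow_one_sub_le (c : R) n : 0 < c <= 1 -> (0 < n)%N -> (1 - c) ^+ n <= (n%:R * c)^-1.
Proof.
move=> /andP[c0 c1] n0; have nc : 0 < n%:R * c by rewrite mulr_gt0// ltr0n.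
apply: (@le_trans _ _ (expR (- c) ^+ n)).
  by rewrite lerXn2r ?nnegrE ?subr_ge0 ?expR_ge0// expR_ge1Dx.
rewrite -expRM_natl mulrN expRN lef_pV2 ?posrE ?expR_gt0//.
by apply: le_trans (expR_ge1Dx _); rewrite lerDr.
Qed.

(** The threshold is 1 - exp(- y) with y = ln K / (K - 1) <= 1, which lies between y / 2 and y; the
    factor K / (K - 1) is between 1 and 2. *)
Lemma threshold_bounds (K : nat) : (2 <= K)%N ->
  [/\ 0 < threshold K :> R, ln K%:R / 2 <= K%:R * threshold K :> R
    & K%:R * threshold K <= 2 * ln K%:R :> R].
Proof.
move=> K2; set k : R := K%:R; have k2 : 2 <= k by rewrite (ler_nat R 2).
pose y := ln k / (k - 1).
have k1 : 0 < k - 1 by lra.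
have lk : 0 < ln k by apply: ln_gt0; lra.
have y0 : 0 < y by rewrite divr_gt0.
have xE : threshold K = 1 - expR (- y).
  rewrite /threshold -/k /powR invr_eq0 gt_eqF; last by lra.
  by rewrite lnV ?posrE ?mulrN /y 1?mulrC//; lra.
have lk1 : ln k <= k - 1.
  have e : 1 + (k - 1) = k by ring.
  by have := @le_ln1Dx R (k - 1); rewrite e; apply; lra.
have y1 : y <= 1 by rewrite ler_pdivrMr// mul1r.
have xy : threshold K <= y by rewrite xE; have := expR_ge1Dx (- y); lra.
have yx : y / 2 <= threshold K.
  rewrite xE expRN; have e1 := expR_ge1Dx y.
  have : (expR y)^-1 <= (1 + y)^-1 by rewrite lef_pV2 ?posrE ?expR_gt0//; lra.
  have : (1 + y)^-1 <= 1 - y / 2.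
    by rewrite -[leLHS]mul1r ler_pdivrMr; nra.
  by lra.
have yk : y * (k - 1) = ln k by rewrite /y divfK// gt_eqF.
by split; nra.
Qed.

Lemma near_powR_ge (s B : R) : 0 < s -> \forall P \near +oo, B <= P `^ s.
Proof.
move=> s0; near=> P.
have b0 : 0 < Num.max B 1 by rewrite lt_max ltr01 orbT.
apply: (@le_trans _ _ (Num.max B 1)); first by rewrite le_max lexx.
rewrite -[leLHS](_ : (Num.max B 1 `^ s^-1) `^ s = _); last first.
  by rewrite -powRrM mulVf ?gt_eqF// powRr1 ?ltW.
have PB : Num.max B 1 `^ s^-1 <= P by near: P; apply: nbhs_pinfty_ge; exact: num_real.
by apply: ge0_ler_powR => //; rewrite ?nnegrE ?powR_ge0 ?ltW// (le_trans (powR_ge0 _ _) PB).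
Unshelve. all: by end_near. Qed.

Lemma near_ln_ge (A : R) : \forall P \near +oo, A <= ln P.
Proof.
near=> P; have PA : expR A <= P by near: P; apply: nbhs_pinfty_ge; exact: num_real.
by rewrite -[leLHS]expRK ler_ln ?posrE ?expR_gt0// (lt_le_trans (expR_gt0 A)).
Unshelve. all: by end_near. Qed.

(** Squaring ln P <= (4 / s) P^(s / 4) uses half of the exponent; the other half absorbs the
    constants. *)
Lemma near_ln_sqr_le (s B : R) : 0 < s ->
  \forall P \near +oo, B * ln P ^+ 2 <= P `^ s.
Proof.
move=> s0; pose A := `|B|; have A0 : 0 <= A by exact: normr_ge0.
have t0 : 0 < s / 4 by lra.
near=> P.
have P1 : 1 <= P by near: P; apply: nbhs_pinfty_ge; exact: num_real.
have L0 : 0 <= ln P by exact: ln_ge0.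
have big : A * (s / 4) ^- 2 <= P `^ (s / 2).
  by near: P; apply: near_powR_ge; rewrite divr_gt0.
have le1 : s / 4 * ln P <= P `^ (s / 4).
  rewrite -ln_powR; set q := P `^ _.
  have q0 : 0 < q by rewrite powR_gt0// (lt_le_trans ltr01).
  have e : 1 + (q - 1) = q by ring.
  by have := @le_ln1Dx R (q - 1); rewrite e => h; apply: le_trans (h _) _; lra.
have half : P `^ (s / 2) = (P `^ (s / 4)) ^+ 2.
  by rewrite -powR_mulrn ?powR_ge0// -powRrM; congr (_ `^ _); lra.
have full : P `^ s = P `^ (s / 2) * P `^ (s / 2).
  rewrite -powRD; first by congr (_ `^ _); lra.
  by apply/implyP => _; rewrite gt_eqF// (lt_le_trans ltr01).
apply: (@le_trans _ _ (A * ln P ^+ 2)).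
  by rewrite ler_wpM2r ?sqr_ge0// ler_norm.
rewrite full; apply: (@le_trans _ _ (A * (s / 4) ^- 2 * P `^ (s / 2))); last first.
  by rewrite ler_wpM2r ?powR_ge0.
rewrite -mulrA ler_wpM2l// half.
have -> : ln P ^+ 2 = (s / 4) ^- 2 * (s / 4 * ln P) ^+ 2.
  by rewrite [(_ * ln P) ^+ 2]exprMn mulKf// expf_neq0// gt_eqF.
rewrite ler_wpM2l ?invr_ge0 ?sqr_ge0//.
by rewrite ler_pXn2r ?nnegrE ?powR_ge0// mulr_ge0// ltW.
Unshelve. all: by end_near. Qed.

Lemma density_min_le1 : density_min <= 1 :> R.
Proof.
rewrite /density_min mulr_ile1 ?expR_ge0 ?invr_ge0 ?sqrtr_ge0//.
by rewrite invf_le1 ?sqrt_pi_ge1// (lt_le_trans ltr01 sqrt_pi_ge1).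
Qed.

(* With [u = P `^ eta] the parameters of [expected_rate_ge] are chosen as
   [M = 16 ln P] and [delta = 1 / u]. *)
Lemma rate_growth (i : 'I_3) (d' eta kappa P : R) (K : nat) :
  0 <= d' <= 1 -> 0 < eta -> 4 * eta < d' -> 0 < kappa -> (2 <= K)%N ->
  1 <= P -> 2 * kappa <= P -> 1 <= ln P ->
  kappa / 2 <= K%:R / P `^ d' -> K%:R / P `^ d' <= 2 * kappa ->
  2 / kappa <= P `^ eta -> 4 <= P `^ eta ->
  [/\ 16 * 128 / kappa * ln P ^+ 2 <= P `^ (d' - eta),
    (1 + 2 * 128 / kappa) * ln P ^+ 2 <= P `^ eta,
    128 * 128 / eta * ln P ^+ 2 <= P `^ eta,
    2 * 96 * kappa / eta <= P
    & (density_min ^+ 8 * d' * eta)^-1 *+ 4 <= ln P] ->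
  (((d' - 4 * eta) * log2 P)%:E <= expected_rate i K (threshold K) P)%E.
Proof.
move=> /andP[d0 d1] eta0 etad kap0 K2 P1 Pkap L1 Klo Khi u1 u4 big.
have P0 : 0 < P by lra.
have [x0 xlo xhi] := @threshold_bounds K K2.
set x := threshold K in x0 xlo xhi *; set k : R := K%:R in Klo Khi xlo xhi *.
set L := ln P in L1 big *; set u := P `^ eta in u1 u4 big.
(* The exponents are tracked through P = D * E and D = u * v. *)
set v := P `^ (d' - eta) in big; set D := P `^ d' in Klo Khi; pose E := P `^ (1 - d').
have k2 : 2 <= k by rewrite (ler_nat R 2).
have k0 : 0 < k by lra.
have u0 : 0 < u by exact: powR_gt0.
have v0 : 0 < v by exact: powR_gt0.
have D0 : 0 < D by exact: powR_gt0.
have E1 : 1 <= E by rewrite -(powRr0 P) ler_powR// subr_ge0.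
have powD a b : P `^ (a + b) = P `^ a * P `^ b.
  by rewrite powRD//; apply/implyP => _; rewrite gt_eqF.
have DE : P = D * E by rewrite -powD addrC subrK powRr1// ltW.
have Duv : D = u * v by rewrite -powD addrC subrK.
rewrite ler_pdivlMr// in Klo; rewrite ler_pdivrMr// in Khi.
have lk : ln k <= 2 * L.
  rewrite -[2 * L](_ : ln (P ^+ 2) = _); last by rewrite lnXn// mulr_natl.
  rewrite ler_ln ?posrE ?exprn_gt0//; apply: (le_trans Khi).
  have DP : D <= P by rewrite DE ler_peMr// ltW.
  by rewrite expr2 ler_pM// ?mulr_ge0// ltW.
have lk' : (d' - eta) * L <= ln k.
  rewrite -ln_powR ler_ln ?posrE//; apply: le_trans Klo.
  have ku : 2 <= u * kappa by rewrite -ler_pdivrMr.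
  rewrite Duv -/v; have := ler_wpM2r (ltW v0) ku; lra.
pose M := 16 * L; pose delta := u^-1.
have xk : x * k <= 4 * L by rewrite mulrC; lra.
have xM0 : 0 < x * M by rewrite mulr_gt0// mulr_gt0//; lra.
(* 128 = 16 * 4 * 2: M is 16 L, K x is at most 4 L and D is at most 2 K / kappa. *)
have xMD : x * M * D <= 128 / kappa * L ^+ 2.
  have kD : D <= 2 / kappa * k.
    by rewrite mulrAC ler_pdivlMr//; lra.
  apply: (@le_trans _ _ (x * M * (2 / kappa * k))); first by rewrite ler_wpM2l// ltW.
  rewrite (_ : x * M * _ = 32 / kappa * L * (x * k)); last by rewrite /M; ring.
  rewrite (_ : 128 / kappa * _ = 32 / kappa * L * (4 * L)); last by ring.
  by rewrite ler_wpM2l// mulr_ge0 ?divr_ge0 ?ltW//; lra.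
have xMd : x * M <= delta / 16.
  rewrite -(ler_pM2r D0); apply: (le_trans xMD).
  rewrite {1}Duv /delta (_ : u^-1 / 16 * (u * v) = v / 16); last first.
    by rewrite mulrAC mulrA mulVf ?gt_eqF// mul1r.
  by have [A1 _ _ _ _] := big; clear -A1; lra.
have del1 : delta <= 1 by rewrite invf_le1//; lra.
have del0 : 0 < delta by rewrite invr_gt0.
have x16 : x <= 16^-1.
  by apply: (@le_trans _ _ (x * M)); [rewrite ler_peMr ?ltW// /M; lra|lra].
pose z := 24 * expR (- M / 8) + 64 * (x * M) * delta.
pose c := 4 * density_min ^+ 8 * x.
have g0 : 0 < (density_min : R) ^+ 8 by rewrite exprn_gt0// density_min_gt0.
have g1 : (density_min : R) ^+ 8 <= 1.
  by rewrite exprn_ile1// ?density_min_le1// ltW// density_min_gt0.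
have eta1 : eta < 1 by clear -etad d1 eta0; lra.
have z0 : 0 <= z.
  have e0 := expR_ge0 (- M / 8); have := mulr_ge0 (ltW xM0) (ltW del0).
  by rewrite /z; move: (expR _) e0 => e e0; clear -e0; lra.
(* With M = 16 ln P the tail exp(- M / 8) is P^-2, while K is O(P); the second term of z, multiplied
   by K, is at most 4096 L^2 / u. *)
have kz : k * z <= eta / 2.
  have eM : expR (- M / 8) = P ^- 2.
    rewrite (_ : - M / 8 = - (2%:R * L)); last by rewrite /M; lra.
    by rewrite expRN expRM_natl lnK.
  have part1 : k * (24 * P ^- 2) <= eta / 4.
    have [_ _ _ Pb _] := big; rewrite ler_pdivrMr// in Pb.
    have DP : D <= P by rewrite DE ler_peMr// ltW.
    rewrite mulrA ler_pdivrMr ?exprn_gt0//.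
    have k2P : k <= 2 * kappa * P.
      by apply: (le_trans Khi); rewrite ler_wpM2l// mulr_ge0// ltW.
    have := ler_wpM2r (ltW P0) Pb; clear -k2P; nra.
  have part2 : k * (64 * (x * M) * delta) <= eta / 4.
    have [_ _ ub _ _] := big; rewrite mulrAC ler_pdivrMr// in ub.
    rewrite (_ : k * _ = 64 * 16 * L * (x * k) / u); last by rewrite /M /delta; ring.
    rewrite ler_pdivrMr//.
    apply: (@le_trans _ _ (64 * 16 * L * (4 * L))); last by clear -ub; nra.
    by rewrite ler_wpM2l// mulr_ge0// ltW// (lt_le_trans ltr01).
  by rewrite /z mulrDr eM; clear -part1 part2; lra.
have c01 : 0 < c <= 1.
  have gx : density_min ^+ 8 * x <= 1 * 16^-1 by apply: ler_pM => //; exact: ltW.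
  have gx0 : 0 < density_min ^+ 8 * x by exact: mulr_gt0.
  rewrite /c -mulrA; move: (_ * x) gx gx0 => y gx gx0.
  by apply/andP; split; clear -gx gx0; lra.
(* K c is at least a multiple of ln K, hence of L, so the last bound in [big] brings it above 2 /
   eta. *)
have nc : (1 - c) ^+ K <= eta / 2.
  have K0 : (0 < K)%N by exact: leq_trans K2.
  apply: le_trans (pow_one_sub_le c01 K0) _; rewrite -/k.
  have kc : 2 / eta <= k * c.
    have [_ _ _ _ Lb] := big.
    have gd : 0 < density_min ^+ 8 * d' * eta.
      do 2 apply: mulr_gt0 => //; clear -etad eta0; lra.
    rewrite -mulr_natl -[4%:R * _]/(4 / _) ler_pdivrMr// in Lb.
    rewrite ler_pdivrMr//.
    have h1 : 2 * density_min ^+ 8 * ln k <= k * c.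
      have := ler_wpM2l (ltW g0) xlo; rewrite /c.
      move: (density_min ^+ 8) => g; clear; lra.
    have h2 : d' * L <= 2 * ln k.
      have := mulr_ge0 (ltW eta0) (le_trans ler01 L1); clear -lk' etad L1 eta0; nra.
    have h3 : density_min ^+ 8 * (d' * L) <= k * c.
      apply: le_trans h1; have := ler_wpM2l (ltW g0) h2.
      by move: (density_min ^+ 8) => g; clear; lra.
    have := ler_wpM2r (ltW eta0) h3; move: (density_min ^+ 8) Lb => g; clear; lra.
  have kc0 : 0 < k * c by apply: lt_le_trans kc; rewrite divr_gt0.
  by rewrite -[leRHS]invrK lef_pV2 ?posrE ?invr_gt0 ?divr_gt0// invfM invrK mulrC.
have z1 : z <= 1.
  have : z <= k * z by rewrite ler_peMl//; clear -k2; lra.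
  by clear -kz eta1; lra.
(* Three factors u are spent: one is 1 / delta, one covers the L^2 in the denominator, one the
   constant 4. *)
have Tlow : (d' - 3 * eta) * log2 P <= selected_rate P M x delta.
  rewrite /selected_rate /log2 mulrA -ln_powR.
  rewrite ler_wpM2r ?invr_ge0 ?ln_ge0 ?ler1n//.
  have den0 : 0 < 1 + P * (2 * (x * M)).
    have PM := mulr_ge0 (ltW P0) (mulr_ge0 (ler0n R 2) (ltW xM0)).
    by rewrite ltr_wpDr.
  have den : 1 + P * (2 * (x * M)) <= E * u.
    have [_ ub _ _ _] := big.
    have L2 : 1 <= L ^+ 2 by rewrite exprn_ege1.
    have E0 : 0 <= E by exact: le_trans E1.
    apply: (@le_trans _ _ (E * (1 + 2 * (128 / kappa * L ^+ 2)))).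
      rewrite {1}DE; have := ler_wpM2l E0 xMD; clear -E1; lra.
    by apply: ler_wpM2l => //; apply: le_trans ub; clear -L2; lra.
  have num0 : 0 <= P * (delta / 4) / (1 + P * (2 * (x * M))).
    exact: divr_ge0 (mulr_ge0 (ltW P0) (divr_ge0 (ltW del0) (ler0n R 4))) (ltW den0).
  rewrite ler_ln ?posrE ?powR_gt0// ?ltr_wpDr//.
  apply: (@le_trans _ _ (P * (delta / 4) / (1 + P * (2 * (x * M))))); last by rewrite lerDr.
  rewrite ler_pdivlMr//; apply: (@le_trans _ _ (P `^ (d' - 3 * eta) * (E * u))).
    by rewrite ler_wpM2l ?powR_ge0.
  have De : P `^ (d' - 3 * eta) * u ^+ 3 = D.
    by rewrite /u -powR_mulrn ?powR_ge0// -powRrM -powD; congr (_ `^ _); clear; ring.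
  rewrite {2}DE -De /delta.
  set y := P `^ _; have y0 : 0 <= y by exact: powR_ge0.
  rewrite (_ : y * u ^+ 3 * E * (u^-1 / 4) = y * E * u * (u / 4)); last first.
    by field; rewrite gt_eqF.
  rewrite mulrA ler_peMr//; last by clear -u4; lra.
  by rewrite !mulr_ge0// ?(ltW u0)// (le_trans ler01).
have M0 : 0 <= M by rewrite /M; clear -L1; lra.
have /andP[_ c1] := c01.
have x016 : 0 < x <= 16^-1 by rewrite x0.
apply: le_trans (expected_rate_ge i K (ltW P0) x016 M0 xMd (ltW del0) z1 c1).
rewrite lee_fin -/z -/c.
have l2 : 0 <= log2 P by rewrite divr_ge0 ?ln_ge0 ?ler1n.
have G : 1 - eta <= (1 - z) ^+ K - (1 - c) ^+ K.
  have := @bernoulli z K; rewrite z0 z1 => /(_ isT); rewrite -/k; clear -kz nc; lra.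
(* Since d' <= 1, the product of d' - 3 eta and 1 - eta is at least d' - 4 eta. *)
apply: (@le_trans _ _ ((d' - 3 * eta) * log2 P * (1 - eta))).
  by rewrite mulrAC ler_wpM2r//; clear -eta0 d1 etad; nra.
by apply: ler_pM => //; [apply: mulr_ge0 => //|]; clear -etad eta0 eta1; lra.
Qed.

End asymptotics.

Theorem theorem1 (R : realType) (i : 'I_3) (d' kappa : R) (K : R -> nat) :
  0 <= d' <= 1 ->
  0 < kappa ->
  (forall P : R, (2 <= K P)%N) ->
  ((K P)%:R / P `^ d' @[P --> +oo] --> kappa) ->
  forall eps : R, 0 < eps ->
    \forall P \near +oo,
      ((d' - eps)%:E <= expected_rate i (K P) (threshold (K P)) P
                        * ((log2 P)^-1)%:E)%E.
Proof.
move=> d01 kappa0 K2 Kcvg eps eps0.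
(* If d' <= eps the bound asked for is at most zero, and the expected rate is non-negative. *)
have [small|big] := leP d' eps.
  near=> P; have P1 : 1 <= P by near: P; apply: nbhs_pinfty_ge; exact: num_real.
  have l2 : 0 <= log2 P by rewrite divr_ge0 ?ln_ge0 ?ler1n.
  apply: (@le_trans _ _ 0%E); first by rewrite lee_fin subr_le0.
  by rewrite mule_ge0 ?expected_rate_ge0 ?lee_fin ?invr_ge0// (le_trans ler01).
(* Then 4 * eta = eps / 2, below both eps and d'. *)
pose eta := eps / 8.
have eta0 : 0 < eta by rewrite divr_gt0.
have etad : 4 * eta < d' by rewrite /eta; lra.
have detad : 0 < d' - eta by lra.
have kap2 : kappa / 2 < kappa by lra.
have kap2' : kappa < 2 * kappa by lra.
have nP B : \forall P \near +oo, B <= P :> R by apply: nbhs_pinfty_ge; exact: num_real.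
have nL := @near_ln_ge R; have nu B := @near_powR_ge R eta B eta0.
have nLu B := @near_ln_sqr_le R eta B eta0.
have nLv B := @near_ln_sqr_le R (d' - eta) B detad.
have nlo := cvgr_ge _ Kcvg _ kap2; have nhi := cvgr_le _ Kcvg _ kap2'.
near=> P.
have P1 : 1 <= P by near: P.
have L1 : 1 <= ln P by near: P.
have log_gt0 : 0 < log2 P by rewrite divr_gt0 ?ln_gt0 ?ltr1n// (lt_le_trans _ L1).
have P2k : 2 * kappa <= P by near: P.
have Pk : 2 * 96 * kappa / eta <= P by near: P.
have Klo : kappa / 2 <= (K P)%:R / P `^ d' by near: P; exact: nlo.
have Khi : (K P)%:R / P `^ d' <= 2 * kappa by near: P; exact: nhi.
have u1 : 2 / kappa <= P `^ eta by near: P; exact: nu.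
have u4 : 4 <= P `^ eta by near: P; exact: nu.
have A1 : 16 * 128 / kappa * ln P ^+ 2 <= P `^ (d' - eta) by near: P; exact: nLv.
have A2 : (1 + 2 * 128 / kappa) * ln P ^+ 2 <= P `^ eta by near: P; exact: nLu.
have A3 : 128 * 128 / eta * ln P ^+ 2 <= P `^ eta by near: P; exact: nLu.
have A4 : (density_min ^+ 8 * d' * eta)^-1 *+ 4 <= ln P by near: P; exact: nL.
have growth := rate_growth i d01 eta0 etad kappa0 (K2 P) P1 P2k L1 Klo Khi u1 u4
  (And5 A1 A2 A3 Pk A4).
apply: (@le_trans _ _ (((d' - 4 * eta) * log2 P)%:E * ((log2 P)^-1)%:E)%E).
  by rewrite -EFinM mulfK ?gt_eqF// lee_fin /eta; clear -eps0; lra.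
by rewrite lee_wpmul2r// lee_fin invr_ge0 ltW.
Unshelve. all: by end_near. Qed.
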